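(* Suppose that the utility fields $U_1,\dots,U_M$ satisfy the Assumption on utilities given in the context, that the total endowment satisfies $\Lambda>0$, that the initial allocation $(\alpha^m_0)_{m=1,\dots,M}$ of $\Lambda$ satisfies $\alpha^m_0\neq 0$ for $m=1,\dots,M$, and that $$\mathbb{E}[|U_m(t\Lambda)|]<\infty,\quad t\in(0,1],\; m=1,\dots,M.$$ Suppose also that there is an index $m_0\in\{1,\dots,M\}$ such that for every $m\neq m_0$ the map $c\mapsto cU'_m(c)$ of $(0,\infty)$ to $\mathbf{L}^0_+$ is non-decreasing. Then an Arrow-Debreu equilibrium exists and is unique.
   Context: Let $M\in\{1,2,\dots\}$ (number of agents) and let $(\mathbf{S},\mathcal{S},\mu)$ be a measure space with $\sigma$-finite measure $\mu$ (the state space). $\mathbf{L}^0$ is the space of ($\mu$-equivalence classes of) measurable functions on $\mathbf{S}$ with values in $[-\infty,\infty)$, and $\mathbf{L}^0_+$ is the cone of non-negative measurable functions. (In)equalities between measurable functions are understood $\mu$-a.e.; $\alpha\neq 0$ means that $\alpha$ is not the zero element of $\mathbf{L}^0$. For $\alpha\in\mathbf{L}^0$ write $\mathbb{E}[\alpha]=\int_{\mathbf{S}}\alpha(s)\,\mu(ds)$, with the convention $\mathbb{E}[\alpha]=-\infty$ whenever $\mathbb{E}[\min(\alpha,0)]=-\infty$. The consumption set of each agent $m=1,\dots,M$ is $\mathbf{L}^0_+$ and his preferences are given by the additive utility $\alpha\mapsto\mathbb{E}[U_m(\alpha)]$, $\alpha\in\mathbf{L}^0_+$, where $U_m:[0,\infty)\to\mathbf{L}^0$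 is a measurable field (for each $c$, $s\mapsto U_m(c)(s)$ is measurable) and $U_m(\alpha)$ denotes $s\mapsto U_m(\alpha(s))(s)$. $U'_m$ is the derivative in $c$. Assumption on utilities: for every $m$ and every $s\in\mathbf{S}$ the function $c\mapsto U_m(c)(s)$ on $(0,\infty)$ is strictly increasing, strictly concave, continuously differentiable, and satisfies the Inada conditions $\lim_{c\to\infty}U_m'(c)(s)=0$ and $\lim_{c\downarrow 0}U_m'(c)(s)=\infty$. At $c=0$, by continuity, $U_m(0)(s)=\lim_{c\downarrow 0}U_m(c)(s)$, which may be $-\infty$. $\Lambda\in\mathbf{L}^0_+$ is the total endowment. An allocation of $\Lambda$ is a family $(\alpha^m)_{m=1,\dots,M}$ of elements of $\mathbf{L}^0_+$ with $\sum_{m=1}^M\alpha^m=\Lambda$. The initial allocation $(\alpha_0^m)_{m=1,\dots,M}$ is a given allocation of $\Lambda$. An Arrow-Debreu equilibrium is a pair $(\zeta,(\alpha_1^m)_{m=1,\dots,M})$ consisting of a measurable function $\zeta>0$ (a state price density) and an allocation $(\alpha^m_1)$ of $\Lambda$ (an equilibrium allocation) such that $\mathbb{E}[\zeta\Lambda]<\infty$ and, for each $m=1,\dots,M$, $\mathbb{E}[|U_m(\alpha^m_1)|]<\infty$ and $\alpha_1^m$ is the maximizer (argmax) of $\mathbb{E}[U_m(\alpha)]$ over all $\alpha\in\mathbf{L}^0_+$ with $\mathbb{E}[\zeta(\alpha-\alpha^m_0)]=0$.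
   Formalization: Uniqueness is understood as uniqueness of the equilibrium allocation (a.e.) and of the state price density ζ up to a positive constant factor, since (kζ, α₁) is an equilibrium for every k>0 whenever (ζ, α₁) is. *)

(* Defs.v *)
From HB Require Import structures.
From mathcomp Require Import all_boot all_order all_algebra.
From mathcomp Require Import all_classical all_reals all_analysis.
From mathcomp Require Import measurable_realfun.

Set Implicit Arguments.
Unset Strict Implicit.
Unset Printing Implicit Defensive.

Import Order.TTheory GRing.Theory Num.Theory.
Import numFieldNormedType.Exports.

Local Open Scope classical_set_scope.
Local Open Scope ring_scope.
Local Open Scope ereal_scope.

Section ArrowDebreu.
Context (d : measure_display) (S : measurableType d) (R : realType).
Implicit Types (mu : {measure set S -> \bar R}) (U : R -> S -> \bar R).
Implicit Types (alpha Lambda zeta : S -> R).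

(* A representative of a class in L^0_+, with values in [0, +oo) everywhere and
   not only almost everywhere: the utility fields are defined on [0, +oo)
   only. Every class in L^0_+ has such a representative. *)
Definition L0plus alpha : Prop :=
  measurable_fun setT alpha /\ forall s, (0 <= alpha s)%R.

(* In \bar R, +oo - oo = -oo, and the integral of f is that of its positive part
   minus that of its negative part: as soon as min(f, 0) has integral -oo, so
   has f. *)
Definition mu_expectation mu (f : S -> \bar R) : \bar R := \int[mu]_s f s.

(* The value U c s is meaningless when c < 0. *)
Definition utility_of U alpha : S -> \bar R := fun s => U (alpha s) s.

(* Read at c > 0 only, where U is real-valued near c. *)
Definition marginal_utility U (c : R) : S -> R :=
  fun s => derive1 (fun x : R => fine (U x s)) c.

Definition strictly_concave_pos (u : R -> R) : Prop :=
  forall x y t : R, (0 < x)%R -> (0 < y)%R -> x != y -> (0 < t < 1)%R ->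
    (t * u x + (1 - t) * u y < u (t * x + (1 - t) * y))%R.

Record utility_field U : Prop := UtilityField {
  utility_measurable : forall c : R, (0 <= c)%R -> measurable_fun setT (U c);
  utility_fin_num : forall (c : R) s, (0 < c)%R -> U c s \is a fin_num;
  utility_increasing : forall (x y : R) s, (0 < x)%R -> (x < y)%R ->
    U x s < U y s;
  utility_strictly_concave : forall s,
    strictly_concave_pos (fun c => fine (U c s));
  utility_derivable : forall (c : R) s, (0 < c)%R ->
    derivable (fun x : R => fine (U x s)) c 1%R;
  utility_C1 : forall (c : R) s, (0 < c)%R ->
    {for c, continuous (fun x : R => marginal_utility U x s)};
  utility_Inada_pinfty : forall s,
    (marginal_utility U x s @[x --> +oo%R] --> (0 : R)%R);
  utility_Inada_0 : forall s,
    (marginal_utility U x s @[x --> (0 : R)%R^'+] --> +oo%R);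
  utility_at0 : forall s, (U x s @[x --> (0 : R)%R^'+] --> U 0%R s)
}.

Definition allocation mu (M : nat) Lambda (alpha : 'I_M -> S -> R) : Prop :=
  (forall m, L0plus (alpha m)) /\
  (fun s => (\sum_(m < M) alpha m s)%R) = Lambda %[ae mu].

Definition budget_set mu zeta alpha0 : set (S -> R) :=
  [set alpha | L0plus alpha /\
    mu_expectation mu (fun s => (zeta s * (alpha s - alpha0 s))%:E) = 0].

Definition is_argmax (A : Type) (F : A -> \bar R) (D : set A) (a : A) : Prop :=
  D a /\ forall b, D b -> F b <= F a.

Definition Arrow_Debreu_equilibrium mu (M : nat) (U : 'I_M -> R -> S -> \bar R)
    Lambda (alpha0 : 'I_M -> S -> R) zeta (alpha1 : 'I_M -> S -> R) : Prop :=
  [/\ measurable_fun setT zeta,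
      (\forall s \ae mu, (0 < zeta s)%R),
      allocation mu Lambda alpha1,
      mu_expectation mu (fun s => (zeta s * Lambda s)%:E) < +oo &
      forall m,
        mu_expectation mu (fun s => `|utility_of (U m) (alpha1 m) s|) < +oo /\
        is_argmax (fun alpha => mu_expectation mu (utility_of (U m) alpha))
          (budget_set mu zeta (alpha0 m)) (alpha1 m)].

(* A positive multiple of a state price density defines the same budget sets:
   prices are only determined up to normalization. *)
Definition same_equilibrium mu (M : nat) zeta (alpha : 'I_M -> S -> R)
    zeta' (alpha' : 'I_M -> S -> R) : Prop :=
  (exists2 k : R, (0 < k)%R & zeta' = (fun s => (k * zeta s)%R) %[ae mu]) /\
  (forall m, alpha' m = alpha m %[ae mu]).

End ArrowDebreu.

(* Main.v *)
(* By the welfare theorems the equilibrium allocations are those that, for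
   some weights w > 0, satisfy w_m U_m'(alpha_m) = zeta in almost every state, at
   weights for which every excess demand h_m(w) = E[zeta (alpha_m - alpha0_m)]
   vanishes. Raising w_j raises zeta and lowers alpha_m for m <> j; as
   c U_m'(c) is non-decreasing, it lowers zeta alpha_m and hence h_m, strictly,
   for every m <> m0 with m <> j. Uniqueness follows by comparing two solutions
   w and w' at an index other than m0 where the ratio w'_m / w_m is extremal.
   For existence no fixed-point theorem is needed: with w_m0 = 1, the weights
   with h_m(w) <= 0 for all m <> m0 are stable under suprema and bounded by
   Walras' law, and their supremum is a zero of h. *)
Require Import Defs.
From HB Require Import structures.
From mathcomp Require Import all_boot all_order all_algebra.
From mathcomp Require Import all_classical all_reals all_analysis.
From mathcomp Require Import measurable_realfun.
From mathcomp Require Import ring lra.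

Set Implicit Arguments.
Unset Strict Implicit.
Unset Printing Implicit Defensive.

Import Order.TTheory GRing.Theory Num.Theory.
Import numFieldNormedType.Exports.

Local Open Scope classical_set_scope.
Local Open Scope ring_scope.

(** * Marginal utilities *)

(** Efficient sharing is solved separately in each state, so the solution is not measurable by
    construction; strict comparison lemmas describe its superlevel sets through marginal utilities
    and their inverses, and measurability is read off from them. Integrability of [zeta * Lambda]
    has to be derived: concavity bounds it by utility increments between [Lambda / (2 M)] and
    [Lambda], integrable by the hypothesis at t = 1 and t = 1 / (2 M). The same increments, times a
    bound on the weights, dominate every passage to the limit. First-order conditions hold off a
    null set that depends on the weights, so limits in the weights are taken along sequences. That
    an equilibrium has weights is shown without differentiating expected utility: if the ratio of
    U'(alpha) to zeta were not constant almost everywhere, the agent would gain by moving constant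
    amounts of consumption between two sets of finite measure with bounded prices, which
    sigma-finiteness supplies. *)

Lemma derivable_cvg_seq (R : realType) (u : R -> R) (x : R) (t : R^nat) :
  derivable u x 1 -> (forall n, t n != 0) -> t @ \oo --> (0 : R) ->
  (t n)^-1 * (u (t n + x) - u x) @[n --> \oo] --> derive1 u x.
Proof.
move=> /cvg_ex[l hl] t0 tc.
have -> : derive1 u x = l.
  by rewrite derive1E; apply: cvg_lim => //; exact: Rhausdorff.
have /cvgr_dnbhsP/(_ t) := hl.
move=> /(_ (conj t0 tc)); apply: cvg_trans; apply: near_eq_cvg.
by apply: nearW => n /=; rewrite /GRing.scale/= mulr1.
Qed.

Lemma cvg_harmonicS (R : realType) : (n.+2%:R : R)^-1 @[n --> \oo] --> (0 : R).
Proof.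
by have := @cvg_harmonic R; rewrite -(cvg_shiftS (@harmonic R)); exact: cvg_trans.
Qed.

Section StrictlyConcave.
Context (R : realType) (u : R -> R).
Hypothesis u_concave : strictly_concave_pos u.
Hypothesis u_derivable : forall c : R, 0 < c -> derivable u c 1.

Let slope_le (x y t : R) : 0 < x -> 0 < y -> 0 < t < 1 ->
  t * (u y - u x) <= u (t * (y - x) + x) - u x.
Proof.
move=> x0 y0 /andP[t0 t1].
have [->|yx] := eqVneq y x; first by rewrite !subrr !mulr0 add0r subrr.
have := u_concave y0 x0 yx; move=> /(_ t); rewrite t0 t1 => /(_ isT).
have -> : t * y + (1 - t) * x = t * (y - x) + x by ring.
by move=> h; lra.
Qed.

(** By concavity every difference quotient along the chord from [x] towards [y], scaled by [y - x],
    is at least [u y - u x]; the step then tends to 0. *)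
Lemma concave_tangent_le (x y : R) : 0 < x -> 0 < y ->
  u y <= u x + derive1 u x * (y - x).
Proof.
move=> x0 y0; have [->|yx] := eqVneq y x; first by rewrite subrr mulr0 addr0.
have yx0 : y - x != 0 by rewrite subr_eq0.
(* [n.+2] keeps [t n] strictly below 1, as the definition of strict concavity requires. *)
pose t (n : nat) : R := (n.+2%:R)^-1.
have t01 n : 0 < t n < 1.
  by rewrite /t invr_gt0 ltr0n/= invf_lt1 ?ltr0n// ltr1n.
have tn0 n : t n != 0 by case/andP: (t01 n) => /gt_eqF ->.
have h0 n : t n * (y - x) != 0 by rewrite mulf_neq0.
have hc : (t n * (y - x)) @[n --> \oo] --> (0 : R).
  by rewrite -[X in _ --> X](mul0r (y - x)); apply: cvgMr_tmp; exact: cvg_harmonicS.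
have c := cvgMr_tmp (b := y - x) (derivable_cvg_seq (u_derivable x0) h0 hc).
rewrite -lerBlDl; apply: (cvgr_to_ge (c _)); apply: nearW => n.
have /andP[tn1 _] := t01 n.
set D := u _ - u x; have -> : (t n * (y - x))^-1 * D * (y - x) = D / t n.
  by field; rewrite tn0 yx0.
rewrite ler_pdivlMr// mulrC.
exact: slope_le.
Qed.

(** Strictness is gained at the midpoint: [u] there exceeds the mean of [u x] and [u y], and the
    weak inequality bounds it by the tangent. *)
Lemma concave_tangent_lt (x y : R) : 0 < x -> 0 < y -> x != y ->
  u y < u x + derive1 u x * (y - x).
Proof.
move=> x0 y0 xy.
have h : 0 < (2^-1 : R) < 1.
  by rewrite invr_gt0 ltr0n/= invf_lt1 ?ltr0n ?ltr1n.
have := u_concave x0 y0 xy h.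
have z0 : 0 < 2^-1 * x + (1 - 2^-1) * y by lra.
by have := concave_tangent_le x0 z0; lra.
Qed.

Lemma concave_derive1_decreasing (x y : R) : 0 < x -> x < y ->
  derive1 u y < derive1 u x.
Proof.
move=> x0 xy; have y0 := lt_trans x0 xy.
have := concave_tangent_lt x0 y0 (negbT (lt_eqF xy)).
have := concave_tangent_lt y0 x0 (negbT (gt_eqF xy)).
move=> h1 h2; have : (derive1 u y - derive1 u x) * (y - x) < 0 by lra.
by rewrite pmulr_llt0 ?subr_gt0// subr_lt0.
Qed.

Lemma concave_derive1_gt0 (x : R) :
  (forall a b, 0 < a -> a < b -> u a < u b) -> 0 < x -> 0 < derive1 u x.
Proof.
move=> inc x0; have x1 : x < x + 1 by lra.
have := concave_tangent_le x0 (lt_trans x0 x1); have := inc _ _ x0 x1; lra.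
Qed.

End StrictlyConcave.

(* Here [v] is the marginal utility as a function of consumption, in a fixed
   state. *)
Record inada (R : realType) (v : R -> R) : Prop := Inada {
  inada_gt0 : forall x, 0 < x -> 0 < v x;
  inada_decreasing : forall x y, 0 < x -> x < y -> v y < v x;
  inada_continuous : forall x, 0 < x -> {for x, continuous v};
  inada_pinfty : v x @[x --> +oo] --> (0 : R);
  inada_0 : v x @[x --> (0 : R)^'+] --> +oo }.

Section Inada.
Context (R : realType) (v : R -> R).
Hypothesis vP : inada v.

Lemma inada_lt (x y : R) : 0 < x -> 0 < y -> (v x < v y) = (y < x).
Proof.
move=> x0 y0; case: (ltgtP x y) => [xy|yx|->]; last by rewrite ltxx.
- by apply/negbTE; rewrite -leNgt ltW// inada_decreasing.
- by rewrite inada_decreasing.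
Qed.

Lemma inada_le (x y : R) : 0 < x -> 0 < y -> (v x <= v y) = (y <= x).
Proof. by move=> x0 y0; rewrite !leNgt inada_lt. Qed.

Lemma inada_surj (y : R) : 0 < y -> exists2 c, 0 < c & v c = y.
Proof.
move=> y0.
have [a a0 ya] : exists2 a, 0 < a & y < v a.
  have /cvgryPgt/(_ y) h := inada_0 vP.
  near (0 : R)^'+ => a; exists a => //; near: a; exact: h.
have [b b0 yb] : exists2 b, 0 < b & v b < y.
  have /cvgr_lt h := inada_pinfty vP.
  by near (pinfty_nbhs R) => b; exists b => //; near: b; exact: h.
have ab : a < b by rewrite -(inada_lt b0 a0) (lt_trans yb).
have [||c cab <-] := @IVT R v a b y (ltW ab).
- apply: continuous_in_subspaceT => x; rewrite inE/= in_itv/= => /andP[ax _].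
  by apply: inada_continuous => //; exact: lt_le_trans ax.
- by rewrite ge_min le_max (ltW ya) (ltW yb) orbT.
by exists c => //; move: cab; rewrite in_itv/= => /andP[/(lt_le_trans a0)].
Unshelve. all: by end_near. Qed.

(** The inverse of [v] on (0, +oo); the default 0 is its value outside the range of [v]. *)
Definition inada_inv (y : R) : R := xget 0 [set c | 0 < c /\ v c = y].

Lemma inada_invP (y : R) : 0 < y -> 0 < inada_inv y /\ v (inada_inv y) = y.
Proof.
move=> /inada_surj[c c0 vc]; rewrite /inada_inv.
by case: xgetP => [x _|/(_ c)[]].
Qed.

Lemma inada_inv_gt (c y : R) : 0 < y -> 0 < c -> (c < inada_inv y) = (y < v c).
Proof.
by move=> y0 c0; have [i0 vi] := inada_invP y0; rewrite -[in RHS]vi inada_lt.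
Qed.

Lemma inada_inv_lt (c y : R) : 0 < y -> 0 < c -> (inada_inv y < c) = (v c < y).
Proof.
by move=> y0 c0; have [i0 vi] := inada_invP y0; rewrite -[in RHS]vi inada_lt.
Qed.

Lemma inada_inv_continuous (y : R) : 0 < y -> {for y, continuous inada_inv}.
Proof.
move=> y0; have [i0 vi] := inada_invP y0.
apply/cvgrPdist_le => e e0.
(* Truncating [e] keeps [c] positive; [v c' < y < v c] is then an open condition on [y] that traps
   the inverse between [c] and [c']. *)
pose e' := Num.min e (inada_inv y / 2).
have e'0 : 0 < e' by rewrite lt_min e0/=; lra.
have e'e : e' <= e by rewrite ge_min lexx.
have e'i : e' <= inada_inv y / 2 by rewrite ge_min lexx orbT.
set c := inada_inv y - e'; set c' := inada_inv y + e'.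
have c0 : 0 < c by rewrite /c; lra.
have c'0 : 0 < c' by rewrite /c'; lra.
have vc : y < v c by rewrite -inada_inv_gt// /c; lra.
have vc' : v c' < y by rewrite -inada_inv_lt// /c'; lra.
near=> x.
have x0 : 0 < x by near: x; exact: lt_nbhsr.
have h1 : c < inada_inv x by rewrite inada_inv_gt//; near: x; exact: lt_nbhsl.
have h2 : inada_inv x < c' by rewrite inada_inv_lt//; near: x; exact: lt_nbhsr.
by rewrite ler_norml; apply/andP; split; rewrite /c /c' in h1 h2; lra.
Unshelve. all: by end_near. Qed.

End Inada.

(** * Sharing an endowment in a fixed state *)

Section Sharing.
Context (R : realType) (M : nat).
Implicit Types (v : 'I_M -> R -> R) (w a : 'I_M -> R).

Lemma ltr_sum_at (f g : 'I_M -> R) (j : 'I_M) :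
  (forall m, f m <= g m) -> f j < g j -> \sum_m f m < \sum_m g m.
Proof.
move=> fg fgj; rewrite (bigD1 j)//= [ltRHS](bigD1 j)//= ltr_leD//.
by apply: ler_sum => m _.
Qed.

Lemma ler_sum_eq (f g : 'I_M -> R) :
  (forall m, f m <= g m) -> \sum_m f m = \sum_m g m -> f =1 g.
Proof.
move=> fg efg j; apply/eqP; rewrite eq_le fg/= leNgt; apply/negP.
by move=> /(ltr_sum_at fg); rewrite efg ltxx.
Qed.

(* First-order conditions of the planner who shares [L] so as to maximize the
   sum of the utilities weighted by [w]; [z] is the multiplier of the resource
   constraint. *)
Record efficient v w (L z : R) a : Prop := Efficient {
  eff_weight : forall m, 0 < w m;
  eff_gt0 : forall m, 0 < a m;
  eff_price : forall m, z = w m * v m (a m);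
  eff_sum : \sum_m a m = L }.

Context (v : 'I_M -> R -> R) (L : R).
Hypothesis vP : forall m, inada (v m).

Lemma eff_price_gt0 w z a (m : 'I_M) : efficient v w L z a -> 0 < z.
Proof.
move=> e; rewrite (eff_price e m) mulr_gt0 ?(eff_weight e)//.
by rewrite (inada_gt0 (vP m)) ?(eff_gt0 e).
Qed.

Lemma eff_le w z a (m : 'I_M) : efficient v w L z a -> a m <= L.
Proof.
move=> e; rewrite -(eff_sum e) (bigD1 m)//= lerDl sumr_ge0// => i _.
exact/ltW/(eff_gt0 e).
Qed.

Lemma eff_scale w z a (k : R) : 0 < k -> efficient v w L z a ->
  efficient v (fun m => k * w m) L (k * z) a.
Proof.
move=> k0 e; split; [|exact: eff_gt0 e| |exact: eff_sum e] => m.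
- by rewrite mulr_gt0 ?(eff_weight e).
- by rewrite (eff_price e m) mulrA.
Qed.

Lemma eff_alloc_gt w z a (m : 'I_M) (c : R) : efficient v w L z a -> 0 < c ->
  (c < a m) = (z < w m * v m c).
Proof.
move=> e c0; rewrite (eff_price e m) ltr_pM2l ?(eff_weight e)//.
by rewrite (inada_lt (vP m))// (eff_gt0 e).
Qed.

Lemma eff_alloc_lt w z a (m : 'I_M) (c : R) : efficient v w L z a -> 0 < c ->
  (a m < c) = (w m * v m c < z).
Proof.
move=> e c0; rewrite (eff_price e m) ltr_pM2l ?(eff_weight e)//.
by rewrite (inada_lt (vP m))// (eff_gt0 e).
Qed.

(** The demand of each agent at price [y] exceeds [a m] exactly when [y < z], so all terms of the
    sum move together. The right-hand side does not mention the solution, whence the measurability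
    of the price. *)
Lemma eff_price_gt w z a (y : R) (i : 'I_M) : efficient v w L z a -> 0 < y ->
  (y < z) = (L < \sum_m inada_inv (v m) (y / w m)).
Proof.
move=> e y0.
have lt_inv m : (a m < inada_inv (v m) (y / w m)) = (y < z).
  rewrite (inada_inv_gt (vP m)) ?(eff_gt0 e) ?divr_gt0 ?(eff_weight e)//.
  by rewrite (eff_price e m) ltr_pdivrMr ?(eff_weight e)// mulrC.
rewrite -(eff_sum e); have [yz|yz] := ltP y z.
  by apply/esym/(@ltr_sum_at _ _ i) => [m|]; rewrite ?ltW ?lt_inv.
apply/esym/negbTE; rewrite -leNgt ler_sum// => m _.
by rewrite leNgt lt_inv -leNgt.
Qed.

(** * Comparison of the solutions for two ordered weight vectors *)

Section Compare.
Context (w w' a a' : 'I_M -> R) (z z' : R).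
Hypothesis e : efficient v w L z a.
Hypothesis e' : efficient v w' L z' a'.
Hypothesis ww' : forall m, w m <= w' m.

(** If higher weights did not raise the price, nobody would consume less; the total being fixed,
    nobody consumes more either. *)
Let alloc_eq : z' <= z -> a =1 a'.
Proof.
move=> zz; apply: ler_sum_eq; last by rewrite (eff_sum e) (eff_sum e').
move=> m; rewrite leNgt (eff_alloc_gt _ e) ?(eff_gt0 e')// -leNgt.
apply: le_trans zz; rewrite (eff_price e' m).
by rewrite ler_wpM2r// ltW// (inada_gt0 (vP m)) ?(eff_gt0 e').
Qed.

Lemma eff_price_lt (j : 'I_M) : w j < w' j -> z < z'.
Proof.
move=> wj; rewrite ltNge; apply/negP => zz.
move: (zz); rewrite (eff_price e j) (eff_price e' j) (alloc_eq zz j).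
by rewrite ler_pM2r ?(inada_gt0 (vP j)) ?(eff_gt0 e')// leNgt wj.
Qed.

Lemma eff_price_le (i : 'I_M) : z <= z'.
Proof.
rewrite leNgt; apply/negP => zz.
move: (zz); rewrite (eff_price e i) (eff_price e' i) (alloc_eq (ltW zz) i).
by rewrite ltr_pM2r ?(inada_gt0 (vP i)) ?(eff_gt0 e')// ltNge ww'.
Qed.

Lemma eff_alloc_ge (k : 'I_M) : w k = w' k -> a' k <= a k.
Proof.
move=> wk; rewrite -(inada_le (vP k)) ?(eff_gt0 e) ?(eff_gt0 e')//.
rewrite -(ler_pM2l (eff_weight e k)) -(eff_price e) wk -(eff_price e').
exact: eff_price_le.
Qed.

Lemma eff_spending_ge (k : 'I_M) : w k = w' k ->
  (forall x y, 0 < x -> x <= y -> x * v k x <= y * v k y) ->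
  z' * a' k <= z * a k.
Proof.
move=> wk mono; rewrite (eff_price e k) (eff_price e' k) -wk -!mulrA.
rewrite ler_pM2l ?(eff_weight e)// ![v k _ * _]mulrC mono ?(eff_gt0 e')//.
exact: eff_alloc_ge.
Qed.

End Compare.

Lemma eff_unique w w' z z' a a' (i : 'I_M) : w =1 w' ->
  efficient v w L z a -> efficient v w' L z' a' -> z = z' /\ a =1 a'.
Proof.
move=> ww' e e'; split=> [|m]; apply/eqP; rewrite eq_le.
  by rewrite (eff_price_le e e') ?(eff_price_le e' e)// => m; rewrite ww'.
by rewrite (eff_alloc_ge e' e) ?(eff_alloc_ge e e')// => k; rewrite ww'.
Qed.

Lemma eff_exists w (i : 'I_M) : 0 < L -> (forall m, 0 < w m) ->
  exists z a, efficient v w L z a.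
Proof.
move=> L0 w0.
have M0 : 0 < M%:R :> R by rewrite ltr0n; case: M i => [[]|].
have M1 : 1 <= M%:R :> R by rewrite ler1n -(ltr0n R).
have LM0 : 0 < L / M%:R by rewrite divr_gt0.
pose S (y : R) : R := \sum_m inada_inv (v m) (y / w m).
(* A bracket for the intermediate value theorem: at [z0] agent [i] alone demands [L], and at [z1]
   every agent demands at most [L / M]. *)
pose z0 := w i * v i L; pose z1 := \sum_m w m * v m (L / M%:R).
have z00 : 0 < z0 by rewrite mulr_gt0// (inada_gt0 (vP i)).
have z01 : z0 <= z1.
  rewrite /z1 (bigD1 i)//= -[leLHS]addr0 lerD//.
    rewrite ler_pM2l// (inada_le (vP i))//.
    by rewrite ler_pdivrMr// ler_peMr// ltW.
  apply: sumr_ge0 => m _; rewrite mulr_ge0// ltW//.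
  by rewrite (inada_gt0 (vP m)).
have Sz0 : L <= S z0.
  rewrite /S (bigD1 i)//= /z0 -[leLHS]addr0 lerD//.
    rewrite leNgt (inada_inv_lt (vP i)) ?divr_gt0//.
    by rewrite mulrAC divff ?gt_eqF// mul1r ltxx.
  by apply: sumr_ge0 => m _; rewrite ltW// (inada_invP (vP m) _).1 ?divr_gt0.
have Sz1 : S z1 <= L.
  have -> : L = \sum_(m < M) (L / M%:R).
    by rewrite sumr_const card_ord -[RHS]mulr_natr divfK// gt_eqF.
  apply: ler_sum => m _; have z10 : 0 < z1 by exact: lt_le_trans z01.
  rewrite leNgt (inada_inv_gt (vP m)) ?divr_gt0// -leNgt.
  rewrite ler_pdivlMr// mulrC /z1 (bigD1 m)//= lerDl sumr_ge0// => j _.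
  by rewrite mulr_ge0// ltW// (inada_gt0 (vP j)).
have S_cont : {within `[z0, z1], continuous S}.
  apply: continuous_in_subspaceT => x; rewrite inE/= in_itv/= => /andP[zx _].
  have x0 : 0 < x by exact: lt_le_trans zx.
  apply: cvg_big => [|m _]; first exact: add_continuous.
  apply: continuous_comp.
    exact: mulrr_continuous.
  by apply: (inada_inv_continuous (vP m)); rewrite divr_gt0.
have [|y] := @IVT R S z0 z1 L z01 S_cont.
  by rewrite ge_min le_max Sz0 Sz1 orbT.
rewrite in_itv/= => /andP[zy _] SL.
have y0 : 0 < y by exact: lt_le_trans zy.
exists y, (fun m => inada_inv (v m) (y / w m)); split=> // m.
  by rewrite (inada_invP (vP m) _).1 ?divr_gt0.
by rewrite (inada_invP (vP m) _).2 ?divr_gt0// mulrC divfK ?gt_eqF.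
Qed.

End Sharing.

(** * Price bound and continuity in the weights *)

Section SharingBounds.
Context (R : realType) (M : nat) (v : 'I_M -> R -> R) (L : R).
Hypothesis vP : forall m, inada (v m).

(* Evaluate the tangents at [a m] at the points [L / (2 M)], which add up to
   [L / 2]. *)
Lemma eff_price_bound (u : 'I_M -> R -> R) (w a : 'I_M -> R) (z : R) :
  (forall m x y, 0 < x -> 0 < y -> u m y <= u m x + v m x * (y - x)) ->
  efficient v w L z a -> 0 < L ->
  z * L <= 2 * \sum_m w m * (u m L - u m (L / (2 * M%:R))).
Proof.
move=> tgt e L0.
have [i _|M0] := pickP (fun m : 'I_M => true); last first.
  have := eff_sum e; rewrite big_pred0 => [L00|m]; last by have := M0 m.
  by rewrite -L00 ltxx in L0.
have M0 : 0 < M%:R :> R by rewrite ltr0n; case: M i => [[]|].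
have {M0}LM0 : 0 < L / (2 * M%:R) by rewrite divr_gt0// mulr_gt0.
set l := L / (2 * M%:R).
have step m : z * (a m - l) <= w m * (u m L - u m l).
  rewrite (eff_price e m) -mulrA ler_pM2l ?(eff_weight e)//.
  have am := eff_gt0 e m.
  have h1 := tgt m _ _ am LM0; rewrite -/l in h1.
  (* That [u m (a m) <= u m L] comes from the tangent at [L], whose slope is positive. *)
  have h2 := tgt m _ _ L0 am.
  have h3 : v m L * (a m - L) <= 0.
    rewrite pmulr_rle0 ?subr_le0 ?(inada_gt0 (vP m))//.
    exact: eff_le e.
  lra.
have : \sum_m z * (a m - l) <= \sum_m w m * (u m L - u m l).
  by apply: ler_sum.
rewrite -mulr_sumr sumrB (eff_sum e) sumr_const card_ord.
have -> : l *+ M = L / 2.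
  rewrite -[LHS]mulr_natr /l; field.
  by rewrite pnatr_eq0; case: M i => [[]|].
lra.
Qed.

(** Homogeneity and monotonicity give continuity: weights within a factor [k] of each other have
    prices within the same factor. The allocation follows, since [eff_alloc_gt] and [eff_alloc_lt]
    turn its bounds into strict inequalities between weights and prices. *)
Lemma eff_cvg (T : Type) (F : set_system T) (FF : Filter F)
    (w_ a_ : T -> 'I_M -> R) (z_ : T -> R) (w a : 'I_M -> R) (z : R) (i : 'I_M) :
  (forall n, efficient v (w_ n) L (z_ n) (a_ n)) -> efficient v w L z a ->
  (forall m, w_ n m @[n --> F] --> w m) ->
  z_ n @[n --> F] --> z /\ forall m, a_ n m @[n --> F] --> a m.
Proof.
move=> e_ e w_w.
have z0 := eff_price_gt0 vP i e.
have zz : z_ n @[n --> F] --> z.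
  apply/cvgrPdist_le => /= d d0.
  (* Chosen so that [k * z = z + d]. *)
  pose k := 1 + d / z.
  have k1 : 1 < k by rewrite /k ltrDl divr_gt0.
  have k0 : 0 < k by lra.
  have kz : k * z = z + d by rewrite /k; field; rewrite gt_eqF.
  have n1 : \forall n \near F, forall m, w_ n m <= k * w m.
    apply: filter_forall => m; apply: (cvgr_le _ (w_w m)).
    by rewrite ltr_pMl ?(eff_weight e).
  have n2 : \forall n \near F, forall m, w m <= k * w_ n m.
    apply: filter_forall => m.
    have : \forall n \near F, w m / k <= w_ n m.
      apply: (cvgr_ge _ (w_w m)).
      by rewrite ltr_pdivrMr// ltr_pMr ?(eff_weight e).
    by apply: filterS => n; rewrite ler_pdivrMr// mulrC.
  apply: filterS2 n1 n2 => n n1 n2.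
  have h1 := eff_price_le vP (e_ n) (eff_scale k0 e) n1 i.
  have h2 := eff_price_le vP e (eff_scale k0 (e_ n)) n2 i.
  rewrite ler_norml; apply/andP; split; first lra.
  rewrite -(ler_pM2l k0); rewrite mulrBr kz.
  have : 0 < (k - 1) * d by rewrite mulr_gt0// subr_gt0.
  lra.
split=> // m; apply/cvgrPdist_le => /= d d0.
pose d' := Num.min d (a m / 2).
have am0 := eff_gt0 e m.
have d'0 : 0 < d' by rewrite lt_min d0/=; lra.
have d'd : d' <= d by rewrite ge_min lexx.
have d'a : d' <= a m / 2 by rewrite ge_min lexx orbT.
have c0 : 0 < a m - d' by lra.
have c'0 : 0 < a m + d' by lra.
have wv_cvg c : w_ n m * v m c - z_ n @[n --> F] --> w m * v m c - z.
  by apply: cvgB => //; apply: cvgMr_tmp.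
have n1 : \forall n \near F, a m - d' < a_ n m.
  have : \forall n \near F, 0 < w_ n m * v m (a m - d') - z_ n.
    apply: (cvgr_gt _ (wv_cvg _)).
    by rewrite subr_gt0 -(eff_alloc_gt vP _ e)//; lra.
  by apply: filterS => n; rewrite subr_gt0 -(eff_alloc_gt vP _ (e_ n)).
have n2 : \forall n \near F, a_ n m < a m + d'.
  have : \forall n \near F, w_ n m * v m (a m + d') - z_ n < 0.
    apply: (cvgr_lt _ (wv_cvg _)).
    by rewrite subr_lt0 -(eff_alloc_lt vP _ e)//; lra.
  by apply: filterS => n; rewrite subr_lt0 -(eff_alloc_lt vP _ (e_ n)).
apply: filterS2 n1 n2 => n n1 n2.
rewrite ler_norml; apply/andP; split; lra.
Qed.

End SharingBounds.

(** * Measurability *)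

Section Measurability.
Context (d : measure_display) (S : measurableType d) (R : realType).

Lemma measurable_ltr_set (f g : S -> R) : measurable_fun setT f ->
  measurable_fun setT g -> measurable [set s | f s < g s].
Proof.
move=> mf mg; have := measurable_fun_ltr mf mg.
by move=> /(_ measurableT [set true]); rewrite setTI; apply.
Qed.

Lemma measurable_fun_gt (D : set S) (f : S -> R) : measurable D ->
  (forall y, measurable (D `&` [set s | y < f s])) -> measurable_fun D f.
Proof.
move=> mD mf; apply: (measurability _ (RGenOInfty.measurableE R)).
move=> _ [_ [y ->] <-]; rewrite (_ : f @^-1` _ = [set s | y < f s])//.
by apply/seteqP; split=> s /=; rewrite in_itv/= andbT.
Qed.

Lemma measurable_fun_gt0 (f : S -> R) : (forall s, 0 < f s) ->
  (forall y, 0 < y -> measurable [set s | y < f s]) -> measurable_fun setT f.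
Proof.
move=> f0 mf; apply: measurable_fun_gt => // y; rewrite setTI.
have [y0|y0] := ltP 0 y; first exact: mf.
rewrite (_ : [set _ | _] = setT)//; apply/seteqP; split=> // s _ /=.
exact: le_lt_trans y0 (f0 s).
Qed.

(** By continuity from the left a value above [y] is already reached at a rational consumption below
    [beta s], and by monotonicity it persists up to [beta s]: superlevel sets are countable
    unions. *)
Lemma measurable_comp_monotone (f : R -> S -> R) (beta : S -> R) :
  measurable_fun setT beta ->
  (forall c, 0 < c -> measurable_fun setT (f c)) ->
  (forall s x y, 0 < x -> x <= y -> f x s <= f y s) ->
  (forall s x, 0 < x -> {for x, continuous (f ^~ s)}) ->
  measurable_fun [set s | 0 < beta s] (fun s => f (beta s) s).
Proof.
move=> mb mf f_mono f_cont.
have m0 : measurable [set s | 0 < beta s] by exact: measurable_ltr_set.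
apply: measurable_fun_gt => // y.
rewrite (_ : _ `&` _ = \bigcup_(q : rat) if 0 < ratr q :> R then
    [set s | ratr q < beta s] `&` [set s | y < f (ratr q) s] else set0).
  apply: bigcupT_measurable_rat => q; case: ifPn => // q0.
  by apply: measurableI; apply: measurable_ltr_set => //; exact: mf.
apply/seteqP; split => [s [/= b0 yf]|s [q _]]; last first.
  case: ifPn => // q0 [/= qb yq].
  split; first exact: lt_trans qb.
  by apply: lt_le_trans yq _; apply: f_mono => //; exact: ltW.
have [x [x0 xb yx]] : exists x, [/\ 0 < x, x < beta s & y < f x s].
  have yc : \forall x \near (beta s)^'-, y < f x s.
    exact: (cvgr_gt _ (cvg_at_left_filter (f_cont _ _ b0))).
  near (beta s)^'- => x; exists x; split.
  - by near: x; exact: nbhs_left_gt.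
  - by near: x; exact: nbhs_left_lt.
  - by near: x; exact: yc.
have [q] := rat_in_itvoo xb; rewrite in_itv/= => /andP[xq qb].
exists q => //; rewrite (lt_trans x0 xq).
by split=> //; apply: lt_le_trans yx _; apply: f_mono => //; exact: ltW.
Unshelve. all: by end_near. Qed.

End Measurability.

(** * Measurable utility fields *)

Section UtilityField.
Context (d : measure_display) (S : measurableType d) (R : realType).
Context (U : R -> S -> \bar R).
Hypothesis UP : utility_field U.

Lemma utility_fineK (c : R) s : 0 < c -> (fine (U c s))%:E = U c s.
Proof. by move=> c0; rewrite fineK// (utility_fin_num UP). Qed.

Lemma utility_inada s : inada (fun c => marginal_utility U c s).
Proof.
have conc := utility_strictly_concave UP s.
have der (c : R) := @utility_derivable _ _ _ _ UP c s.
split.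
- move=> x x0; apply: (concave_derive1_gt0 conc der) => // a b a0 ab.
  have b0 := lt_trans a0 ab.
  by rewrite -lte_fin !utility_fineK//; exact: utility_increasing.
- by move=> x y x0 xy; exact: (concave_derive1_decreasing conc der).
- by move=> x x0; exact: utility_C1.
- exact: utility_Inada_pinfty.
- exact: utility_Inada_0.
Qed.

Lemma utility_tangent (x y : R) s : 0 < x -> 0 < y ->
  fine (U y s) <= fine (U x s) + marginal_utility U x s * (y - x).
Proof.
move=> x0 y0; apply: (@concave_tangent_le _ (fun c => fine (U c s))) => //.
  exact: utility_strictly_concave.
by move=> c c0; exact: utility_derivable.
Qed.

(** At [y = 0] the utility is a right limit, possibly -oo, and the inequality survives the limit.
    Competing consumption plans may vanish, so this case does occur. *)
Lemma utility_tangent0 (x y : R) s : 0 < x -> 0 <= y ->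
  (U y s <= U x s + (marginal_utility U x s * (y - x))%:E)%E.
Proof.
move=> x0; rewrite le_eqVlt => /predU1P[<-|y0]; last first.
  by rewrite -(utility_fineK _ x0) -(utility_fineK _ y0) -EFinD lee_fin utility_tangent.
set v := marginal_utility U x s.
have h : ((fine (U x s) + v * (t - x))%:E) @[t --> (0 : R)^'+] -->
    (fine (U x s) + v * (0 - x))%:E.
  apply: cvg_EFin; first exact: nearW.
  apply: cvg_at_right_filter; apply: cvgD; first exact: cvg_cst.
  by apply: cvgMl_tmp; apply: cvgB; [exact: cvg_id|exact: cvg_cst].
rewrite -(utility_fineK _ x0) -EFinD.
apply: lee_cvg_to (@utility_at0 _ _ _ _ UP s) h _.
near=> t.
have t0 : 0 < t by near: t; exact: nbhs_right_gt.
by rewrite -(utility_fineK _ t0) lee_fin utility_tangent.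
Unshelve. all: by end_near. Qed.

Lemma utility_le (x y : R) s : 0 < x -> x <= y -> (U x s <= U y s)%E.
Proof.
move=> x0; rewrite le_eqVlt => /predU1P[->//|xy].
exact/ltW/(utility_increasing UP).
Qed.

Lemma measurable_marginal_utility (c : R) : 0 < c ->
  measurable_fun setT (marginal_utility U c).
Proof.
(* The derivative is a pointwise limit of measurable difference quotients. *)
move=> c0; pose t (n : nat) : R := (n.+2%:R)^-1.
have t0 n : 0 < t n by rewrite /t invr_gt0 ltr0n.
apply: (@measurable_fun_cvg _ _ _ _
  (fun n s => (t n)^-1 * (fine (U (t n + c) s) - fine (U c s)))) => [n|s _].
  have mU x : 0 < x -> measurable_fun setT (fun s => fine (U x s)).
    move=> x0; apply: measurableT_comp => //.
    by apply: utility_measurable => //; exact: ltW.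
  apply: measurable_funM => //; apply: measurable_funB; apply: mU => //.
  exact: addr_gt0.
apply: (@derivable_cvg_seq _ (fun x => fine (U x s))).
- exact: utility_derivable.
- by move=> n; rewrite gt_eqF.
- exact: cvg_harmonicS.
Qed.

Lemma measurable_marginal_utility_comp (beta : S -> R) :
  measurable_fun setT beta ->
  measurable_fun [set s | 0 < beta s] (fun s => marginal_utility U (beta s) s).
Proof.
move=> mb.
(* Marginal utility decreases in consumption, hence the passage to its opposite. *)
have : measurable_fun [set s | 0 < beta s]
    (fun s => (fun c s => - marginal_utility U c s) (beta s) s).
  apply: (@measurable_comp_monotone _ _ _
    (fun c s => - marginal_utility U c s)) => // [c c0|s x y x0 xy|s x x0].
  - by apply: measurableT_comp => //; exact: measurable_marginal_utility.
  - by rewrite lerN2 (inada_le (utility_inada s))// (lt_le_trans x0).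
  - by apply: cvgN; exact: utility_C1.
move=> /(measurableT_comp (@oppr_measurable R setT)).
by apply: eq_measurable_fun => s _ /=; rewrite opprK.
Qed.

Lemma measurable_utility_of (beta : S -> R) :
  L0plus beta -> measurable_fun setT (utility_of U beta).
Proof.
move=> [mb b0].
have m0 : measurable [set s | 0 < beta s] by exact: measurable_ltr_set.
(* At zero consumption the utility may be -oo, so these states are treated apart. *)
rewrite -(setvU [set s | 0 < beta s]); apply/measurable_funU => //.
  exact: measurableC.
split.
  apply: (@eq_measurable_fun _ _ _ _ _ (U 0)) => [s|].
    rewrite inE/= => /negP; rewrite -leNgt => bs.
    by rewrite /utility_of (_ : beta s = 0)//; apply/eqP; rewrite eq_le bs b0.
  by apply: measurable_funTS; exact: utility_measurable.
apply: (@eq_measurable_fun _ _ _ _ _ (EFin \o (fun s => fine (U (beta s) s)))).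
  by move=> s; rewrite inE/= => bs; rewrite utility_fineK.
apply/measurable_EFinP.
apply: (@measurable_comp_monotone _ _ _ (fun c s => fine (U c s))) => //.
- move=> c c0; apply: measurableT_comp => //.
  by apply: utility_measurable => //; exact: ltW.
- move=> s x y x0 xy; have y0 := lt_le_trans x0 xy.
  by rewrite -lee_fin !utility_fineK// utility_le.
- move=> s x x0; apply: differentiable_continuous.
  by apply/derivable1_diffP; exact: utility_derivable.
Qed.

End UtilityField.

(** * Integrals and almost everywhere inequalities *)

Section AlmostEverywhere.
Context (d : measure_display) (S : measurableType d) (R : realType).
Context (mu : {measure set S -> \bar R}).
Implicit Types f g : S -> R.

Lemma integrable_realD f g : mu.-integrable setT (EFin \o f) ->
  mu.-integrable setT (EFin \o g) ->
  mu.-integrable setT (EFin \o (fun s => f s + g s)).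
Proof. by move=> If Ig; exact: (integrableD measurableT If Ig). Qed.

Lemma integrable_realB f g : mu.-integrable setT (EFin \o f) ->
  mu.-integrable setT (EFin \o g) ->
  mu.-integrable setT (EFin \o (fun s => f s - g s)).
Proof. by move=> If Ig; exact: (integrableB measurableT If Ig). Qed.

Lemma integrable_realZ (k : R) f : mu.-integrable setT (EFin \o f) ->
  mu.-integrable setT (EFin \o (fun s => k * f s)).
Proof. by move=> If; exact: (integrableZl measurableT k If). Qed.

Lemma integrable_real_sum (I : finType) (h : I -> S -> R) :
  (forall i, mu.-integrable setT (EFin \o h i)) ->
  mu.-integrable setT (EFin \o (fun s => \sum_i h i s)).
Proof.
move=> Ih; have := @integrable_sum _ _ _ mu setT measurableT _ (index_enum I)
  predT (fun i => EFin \o h i) (fun i _ => Ih i).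
by apply: eq_integrable => // s _ /=; rewrite sumEFin.
Qed.

Lemma Rintegral_sum (I : finType) (h : I -> S -> R) :
  (forall i, mu.-integrable setT (EFin \o h i)) ->
  \int[mu]_s (\sum_i h i s) = \sum_i \int[mu]_s h i s.
Proof.
move=> Ih; apply: EFin_inj; rewrite -sumEFin /Rintegral fineK; last first.
  by apply: integrable_fin_num => //; exact: integrable_real_sum.
under eq_integral do rewrite -sumEFin.
rewrite integral_sum//; apply: eq_bigr => i _.
by rewrite fineK// (integrable_fin_num _ (Ih i)).
Qed.

Lemma ae_eq_Rintegral f g : measurable_fun setT f -> measurable_fun setT g ->
  (\forall s \ae mu, f s = g s) -> \int[mu]_s f s = \int[mu]_s g s.
Proof.
move=> mf mg fg; congr fine; apply: ae_eq_integral => //.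
- exact/measurable_EFinP.
- exact/measurable_EFinP.
- by apply: filterS fg => s ->.
Qed.

Lemma ae_le_integrable f g : measurable_fun setT f ->
  mu.-integrable setT (EFin \o g) -> (\forall s \ae mu, `|f s| <= g s) ->
  mu.-integrable setT (EFin \o f).
Proof.
move=> mf ig fg; have mg := measurable_int mu ig.
apply/integrableP; split; first exact/measurable_EFinP.
have /integrableP[_] := ig; apply: le_lt_trans.
apply: ae_ge0_le_integral => //.
- by apply: measurableT_comp => //; exact/measurable_EFinP.
- exact: measurableT_comp.
by apply: filterS fg => s fg _ /=; rewrite lee_fin (le_trans fg)// ler_norm.
Qed.

Lemma ae_le_integral (f g : S -> \bar R) : measurable_fun setT f ->
  measurable_fun setT g -> (\forall s \ae mu, (f s <= g s)%E) ->
  (\int[mu]_s f s <= \int[mu]_s g s)%E.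
Proof.
move=> mf mg fg; rewrite integralE [leRHS]integralE; apply: leeB;
  apply: ae_ge0_le_integral => //.
- exact: measurable_funepos.
- exact: measurable_funepos.
- by apply: filterS fg => s fg _; rewrite !funeposE ge_max !le_max fg lexx orbT.
- exact: measurable_funeneg.
- exact: measurable_funeneg.
- by apply: filterS fg => s fg _; rewrite !funenegE ge_max !le_max leeN2 fg lexx orbT.
Qed.

Lemma ae_le_Rintegral f g : mu.-integrable setT (EFin \o f) ->
  mu.-integrable setT (EFin \o g) -> (\forall s \ae mu, f s <= g s) ->
  \int[mu]_s f s <= \int[mu]_s g s.
Proof.
move=> If Ig fg; rewrite /Rintegral fine_le ?integrable_fin_num//.
apply: ae_le_integral.
- exact: measurable_int If.
- exact: measurable_int Ig.
- by apply: filterS fg => s; rewrite lee_fin.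
Qed.

Lemma Rintegral_eq0_ae f : mu.-integrable setT (EFin \o f) ->
  (\forall s \ae mu, 0 <= f s) -> \int[mu]_s f s <= 0 ->
  \forall s \ae mu, f s = 0.
Proof.
move=> If f0 intf.
have mf := measurable_int mu If.
have : (\int[mu]_s `|(EFin \o f) s| = 0)%E.
  rewrite (@ae_eq_integral _ _ _ _ _ (EFin \o f))//; last 2 first.
  - exact: measurableT_comp.
  - by apply: filterS f0 => s f0 _ /=; rewrite ger0_norm.
  apply/eqP; rewrite eq_le; apply/andP; split.
    by move: intf; rewrite -lee_fin /Rintegral fineK// integrable_fin_num.
  rewrite -(@integral0 _ _ _ mu setT).
  exact: ae_le_integral.
move=> /(ae_eq_integral_abs mu measurableT mf).
by apply: filterS => s /(_ I) /= [].
Qed.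

Lemma ae_lt_Rintegral f g : mu.-integrable setT (EFin \o f) ->
  mu.-integrable setT (EFin \o g) -> (\forall s \ae mu, f s <= g s) ->
  ~ (\forall s \ae mu, f s = g s) ->
  \int[mu]_s f s < \int[mu]_s g s.
Proof.
move=> If Ig fg; apply: contra_notP => /negP; rewrite -leNgt => intgf.
have Igf : mu.-integrable setT (EFin \o (g \- f)) by exact: integrable_realB.
have : \forall s \ae mu, (g \- f) s = 0.
  apply: Rintegral_eq0_ae => //.
    by apply: filterS fg => s; rewrite subr_ge0.
  by rewrite RintegralB// subr_le0.
by apply: filterS => s /eqP; rewrite subr_eq0 => /eqP.
Qed.

(** As +oo - oo is -oo, a finite integral forces both the positive and the negative part to have
    finite integrals. This extracts integrability from a budget equation. *)
Lemma fin_num_integrable f : measurable_fun setT f ->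
  (\int[mu]_s (f s)%:E)%E \is a fin_num -> mu.-integrable setT (EFin \o f).
Proof.
move=> mf; rewrite integralE => fin.
have mfE : measurable_fun setT (EFin \o f) by exact/measurable_EFinP.
apply/integrableP; split => //.
have -> : (fun s => `|(EFin \o f) s|)%E = ((EFin \o f)^\+ \+ (EFin \o f)^\-)%E.
  by rewrite -fune_abse.
rewrite ge0_integralD//; last 2 first.
- exact: measurable_funepos.
- exact: measurable_funeneg.
have p0 : (0 <= \int[mu]_s (EFin \o f)^\+ s)%E by exact: integral_ge0.
have n0 : (0 <= \int[mu]_s (EFin \o f)^\- s)%E by exact: integral_ge0.
move: fin p0 n0; rewrite -/(EFin \o f).
case: (\int[mu]_s (EFin \o f)^\+ s)%E => [x||] //;
  case: (\int[mu]_s (EFin \o f)^\- s)%E => [y||] //.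
by move=> _ _ _; rewrite -EFinD ltry.
Qed.

Lemma Rintegral_dominated_cvg (f_ : nat -> S -> R) f g :
  (forall n, measurable_fun setT (f_ n)) -> measurable_fun setT f ->
  mu.-integrable setT (EFin \o g) ->
  (\forall s \ae mu, forall n, `|f_ n s| <= g s) ->
  (\forall s \ae mu, f_ n s @[n --> \oo] --> f s) ->
  \int[mu]_s f_ n s @[n --> \oo] --> \int[mu]_s f s.
Proof.
move=> mf_ mf Ig f_g f_f.
have [||||| If _ intf] := @dominated_convergence _ _ _ mu setT measurableT
  (fun n => EFin \o f_ n) (EFin \o f) (EFin \o g).
- by move=> n; exact/measurable_EFinP.
- exact/measurable_EFinP.
- by apply: filterS f_f => s fs _; apply: cvg_EFin => //; exact: nearW.
- exact: Ig.
- by apply: filterS f_g => s fs n _; rewrite lee_fin.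
apply: fine_cvg; rewrite fineK//; exact: integrable_fin_num.
Qed.

End AlmostEverywhere.

(** * Excess demand *)

Section Economy.
Context (d : measure_display) (S : measurableType d) (R : realType).
Context (mu : {measure set S -> \bar R}) (M : nat).
Context (U : 'I_M -> R -> S -> \bar R) (Lambda : S -> R).
Context (alpha0 : 'I_M -> S -> R).
Hypothesis UP : forall m, utility_field (U m).
Hypothesis Lambda_L0plus : L0plus Lambda.
Hypothesis Lambda_gt0 : \forall s \ae mu, 0 < Lambda s.
Hypothesis alpha0_allocation : allocation mu Lambda alpha0.
Hypothesis alpha0_neq0 : forall m, ~ (alpha0 m = cst 0 %[ae mu]).
Hypothesis U_integrable : forall (t : R) (m : 'I_M), 0 < t <= 1 ->
  (mu_expectation mu
     (fun s => `|utility_of (U m) (fun s' => (t * Lambda s')%R) s|) < +oo)%E.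

Definition marginals (s : S) : 'I_M -> R -> R :=
  fun m c => marginal_utility (U m) c s.

Record optimal (w : 'I_M -> R) (zeta : S -> R) (alpha : 'I_M -> S -> R) : Prop
    := Optimal {
  opt_price : measurable_fun setT zeta;
  opt_alloc : forall m, L0plus (alpha m);
  opt_eff : \forall s \ae mu,
    efficient (marginals s) w (Lambda s) (zeta s) (alpha^~ s) }.

Lemma marginals_inada s m : inada (marginals s m).
Proof. exact: utility_inada. Qed.
Let inadaP := marginals_inada.

(* [Lambda] is positive only almost everywhere; with this representative the
   sharing problem has a solution in every state. *)
Definition posLambda (s : S) : R := if 0 < Lambda s then Lambda s else 1.

Lemma posLambda_gt0 s : 0 < posLambda s.
Proof. by rewrite /posLambda; case: ifPn. Qed.

Lemma measurable_posLambda : measurable_fun setT posLambda.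
Proof.
have [mL _] := Lambda_L0plus.
by apply: measurable_fun_ifT => //; exact: measurable_fun_ltr.
Qed.

(** The solutions are chosen state by state. Their superlevel sets are then rewritten by
    [eff_price_gt] and [eff_alloc_gt] as inequalities between measurable functions, so no measurable
    selection is involved. *)
Lemma optimal_exists (i : 'I_M) (w : 'I_M -> R) : (forall m, 0 < w m) ->
  exists zeta alpha, optimal w zeta alpha.
Proof.
move=> w0.
have /choice[f fP] : forall s, exists p : R * ('I_M -> R),
    efficient (marginals s) w (posLambda s) p.1 p.2.
  move=> s; have [z [a e]] := eff_exists (inadaP s) i (posLambda_gt0 s) w0.
  by exists (z, a).
pose zeta s := (f s).1; pose alpha m s := (f s).2 m.
have mv m c : 0 < c -> measurable_fun setT (fun s => marginals s m c).
  by move=> c0; exact: (measurable_marginal_utility (UP m)).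
have minv m (y : R) : 0 < y ->
    measurable_fun setT (fun s => inada_inv (marginals s m) y).
  move=> y0; apply: measurable_fun_gt0 => [s|c c0].
    by case: (inada_invP (inadaP s m) y0).
  rewrite (_ : [set _ | _] = [set s | y < marginals s m c]).
    by apply: measurable_ltr_set => //; exact: mv.
  by apply/seteqP; split=> s /=; rewrite (inada_inv_gt (inadaP s m)).
have mzeta : measurable_fun setT zeta.
  apply: measurable_fun_gt0 => [s|y y0].
    exact: (eff_price_gt0 (inadaP s) i (fP s)).
  rewrite (_ : [set _ | _] = [set s | posLambda s <
      \sum_m inada_inv (marginals s m) (y / w m)]).
    apply: measurable_ltr_set; first exact: measurable_posLambda.
    apply: measurable_sum => m; apply: minv; exact: divr_gt0.
  apply/seteqP; split=> s /=;
    by rewrite (eff_price_gt (inadaP s) i (fP s)).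
exists zeta, alpha; split=> // [m|].
  split=> [|s]; last exact/ltW/(eff_gt0 (fP s)).
  apply: measurable_fun_gt0 => [s|c c0]; first exact: (eff_gt0 (fP s)).
  rewrite (_ : [set _ | _] = [set s | zeta s < w m * marginals s m c]).
    by apply: measurable_ltr_set => //; apply: measurable_funM => //; exact: mv.
  apply/seteqP; split=> s /=;
    by rewrite (eff_alloc_gt (inadaP s) m (fP s)).
apply: filterS Lambda_gt0 => s L0; have := fP s.
by rewrite /posLambda L0.
Qed.

Lemma optimal_scale (k : R) w zeta alpha : 0 < k -> optimal w zeta alpha ->
  optimal (fun m => k * w m) (fun s => k * zeta s) alpha.
Proof.
move=> k0 [mz La e]; split=> //; first exact: measurable_funM.
by apply: filterS e => s; exact: eff_scale.
Qed.

Lemma utility_integrable m (t : R) : 0 < t <= 1 ->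
  mu.-integrable setT (EFin \o (fun s => fine (U m (t * Lambda s) s))).
Proof.
move=> t01; have [mL L0] := Lambda_L0plus.
have mU : measurable_fun setT (utility_of (U m) (fun s => t * Lambda s)).
  apply: measurable_utility_of => //; split; first exact: measurable_funM.
  by move=> s; rewrite mulr_ge0// ltW//; case/andP: t01.
have IU : mu.-integrable setT (utility_of (U m) (fun s => t * Lambda s)).
  by apply/integrableP; split=> //; exact: U_integrable.
apply: le_integrable IU => //.
  by apply/measurable_EFinP; exact: measurableT_comp.
(* [fine] sends infinite values to 0, so it does not increase absolute values. *)
move=> s _ /=; rewrite /utility_of; case: (U m _ s) => [x||]//=;
  by rewrite normr0 leey.
Qed.

(* The right-hand side of [eff_price_bound] for unit weights. *)
Definition spending_bound (s : S) : R := 2 * \sum_m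
  (fine (U m (1 * Lambda s) s) - fine (U m ((2 * M%:R)^-1 * Lambda s) s)).

Lemma spending_bound_integrable (i : 'I_M) :
  mu.-integrable setT (EFin \o spending_bound).
Proof.
apply: integrable_realZ.
apply: integrable_real_sum => m; apply: integrable_realB.
  by apply: utility_integrable; rewrite ltr01 lexx.
apply: utility_integrable.
have M1 : 1 <= M%:R :> R by rewrite ler1n; case: M i => [[]|].
by rewrite invr_gt0 invf_le1 mulr_gt0//; lra.
Qed.

(** One integrable envelope for all weights bounded by [K]: the utility increments are non-negative,
    so each weight may be replaced by [K]. *)
Lemma price_le_bound (K : R) (w : 'I_M -> R) zeta alpha :
  (forall m, w m <= K) -> optimal w zeta alpha ->
  \forall s \ae mu, zeta s * Lambda s <= K * spending_bound s.
Proof.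
move=> wK [_ _ opt]; apply: filterS2 opt Lambda_gt0 => s e L0.
apply: le_trans (eff_price_bound (inadaP s) (u := fun m c => fine (U m c s)) _ e L0) _.
  by move=> m x y x0 y0; exact: utility_tangent.
rewrite /spending_bound mulrCA ler_pM2l// mulr_sumr; apply: ler_sum => m _.
rewrite mul1r [_^-1 * _]mulrC ler_wpM2r//.
have M1 : 1 <= M%:R :> R by rewrite ler1n; case: M m => [[]|].
have M2 : 0 < 2 * M%:R :> R by lra.
have l0 : 0 < Lambda s / (2 * M%:R) by rewrite divr_gt0.
rewrite subr_ge0 -lee_fin !(utility_fineK (UP m))//.
apply: (utility_le (UP m)) => //; rewrite ler_pdivrMr// ler_peMr ?ltW//; lra.
Qed.

Lemma allocation_le (alpha : 'I_M -> S -> R) : allocation mu Lambda alpha ->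
  \forall s \ae mu, forall m, `|alpha m s| <= Lambda s.
Proof.
move=> [La sa]; apply: filterS sa => s /(_ I) <- m.
rewrite ger0_norm ?(La m).2// (bigD1 m)//= lerDl sumr_ge0// => j _.
exact: (La j).2.
Qed.

Lemma optimal_allocation w zeta alpha : optimal w zeta alpha ->
  allocation mu Lambda alpha.
Proof.
move=> [_ La opt]; split=> //; apply: filterS opt => s e _.
exact: (eff_sum e).
Qed.

Lemma optimal_price_gt0 (i : 'I_M) w zeta alpha : optimal w zeta alpha ->
  \forall s \ae mu, 0 < zeta s.
Proof.
by move=> [_ _]; apply: filterS => s; exact: (eff_price_gt0 (inadaP s) i).
Qed.

Lemma optimal_price_integrable (i : 'I_M) w zeta alpha : optimal w zeta alpha ->
  mu.-integrable setT (EFin \o (fun s => zeta s * Lambda s)).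
Proof.
move=> opt; have [mL L0] := Lambda_L0plus.
have wK m : w m <= \sum_j `|w j|.
  by rewrite (bigD1 m)//= (le_trans (ler_norm _))// lerDl sumr_ge0.
apply: (ae_le_integrable (g := fun s => (\sum_j `|w j|) * spending_bound s)).
- by apply: measurable_funM => //; exact: opt_price opt.
- by apply: integrable_realZ; exact: spending_bound_integrable.
apply: filterS2 (price_le_bound wK opt) (optimal_price_gt0 i opt) => s b z0.
by rewrite ger0_norm// mulr_ge0// ltW.
Qed.

Section PriceDensity.
Context (zeta : S -> R).
Hypothesis mzeta : measurable_fun setT zeta.
Hypothesis zeta_gt0 : \forall s \ae mu, 0 < zeta s.
Hypothesis zetaLambda :
  mu.-integrable setT (EFin \o (fun s => zeta s * Lambda s)).

Lemma spending_integrable (a : S -> R) : measurable_fun setT a ->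
  (\forall s \ae mu, `|a s| <= Lambda s) ->
  mu.-integrable setT (EFin \o (fun s => zeta s * a s)).
Proof.
move=> ma aL; apply: ae_le_integrable zetaLambda _.
  exact: measurable_funM.
apply: filterS2 aL zeta_gt0 => s aL z0.
by rewrite normrM gtr0_norm// ler_pM2l.
Qed.

Lemma alpha0_spending_integrable m :
  mu.-integrable setT (EFin \o (fun s => zeta s * alpha0 m s)).
Proof.
apply: spending_integrable; first by case: (alpha0_allocation.1 m).
by apply: filterS (allocation_le alpha0_allocation) => s /(_ m).
Qed.

Lemma alpha0_spending_gt0 m : 0 < \int[mu]_s (zeta s * alpha0 m s).
Proof.
have a00 : \forall s \ae mu, 0 <= zeta s * alpha0 m s.
  apply: filterS zeta_gt0 => s z0; apply: mulr_ge0; first exact: ltW.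
  exact: (alpha0_allocation.1 m).2.
rewrite ltNge; apply/negP.
move=> /(Rintegral_eq0_ae (alpha0_spending_integrable m) a00) za.
apply: (alpha0_neq0 (m := m)); apply: filterS2 za zeta_gt0 => s /eqP + z0 _.
by rewrite mulf_eq0 gt_eqF//= => /eqP.
Qed.

End PriceDensity.

Definition excess (zeta a : S -> R) (m : 'I_M) : R :=
  \int[mu]_s (zeta s * (a s - alpha0 m s)).

Lemma excess_integrable (i : 'I_M) w zeta alpha m : optimal w zeta alpha ->
  mu.-integrable setT (EFin \o (fun s => zeta s * (alpha m s - alpha0 m s))).
Proof.
move=> opt; have z0 := optimal_price_gt0 i opt.
have zL := optimal_price_integrable i opt.
have mz := opt_price opt.
have -> : (fun s => zeta s * (alpha m s - alpha0 m s)) =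
    (fun s => zeta s * alpha m s - zeta s * alpha0 m s).
  by apply/funext => s; rewrite mulrBr.
apply: integrable_realB; last exact: alpha0_spending_integrable.
apply: spending_integrable => //; first by case: (opt_alloc opt m).
by apply: filterS (allocation_le (optimal_allocation opt)) => s /(_ m).
Qed.

Lemma excessE (i : 'I_M) w zeta alpha m : optimal w zeta alpha ->
  excess zeta (alpha m) m =
  \int[mu]_s (zeta s * alpha m s) - \int[mu]_s (zeta s * alpha0 m s).
Proof.
move=> opt; have z0 := optimal_price_gt0 i opt.
have zL := optimal_price_integrable i opt.
have mz := opt_price opt.
rewrite -RintegralB//; last 2 first.
- apply: spending_integrable => //; first by case: (opt_alloc opt m).
  by apply: filterS (allocation_le (optimal_allocation opt)) => s /(_ m).
- exact: alpha0_spending_integrable.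
by apply: eq_Rintegral => s _; rewrite mulrBr.
Qed.

Lemma excess_scale (i : 'I_M) (k : R) w zeta alpha m : optimal w zeta alpha ->
  excess (fun s => k * zeta s) (alpha m) m = k * excess zeta (alpha m) m.
Proof.
move=> opt; rewrite -RintegralZl//; last exact: excess_integrable opt.
by apply: eq_Rintegral => s _; rewrite mulrA.
Qed.

Lemma walras (i : 'I_M) w zeta alpha : optimal w zeta alpha ->
  \sum_m excess zeta (alpha m) m = 0.
Proof.
move=> opt.
rewrite -Rintegral_sum; last by move=> m; exact: excess_integrable opt.
transitivity (\int[mu]_(s in setT) (0 : R)); last first.
  by rewrite Rintegral_cst// mul0r.
apply: ae_eq_Rintegral => //.
  apply: measurable_sum => m; apply: measurable_funM; first exact: opt_price opt.
  apply: measurable_funB; first by case: (opt_alloc opt m).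
  by case: (alpha0_allocation.1 m).
apply: filterS2 (opt_eff opt) alpha0_allocation.2 => s e /(_ I) a0L.
by rewrite -mulr_sumr sumrB (eff_sum e) a0L subrr mulr0.
Qed.

(* Gross substitutes: raising the weights of the other agents
   lowers the excess demand of an agent whose marginal spending
   [c U'(c)] is non-decreasing. *)
Section ExcessComparison.
Context (w w' : 'I_M -> R) (zeta zeta' : S -> R) (alpha alpha' : 'I_M -> S -> R).
Context (k : 'I_M).
Hypothesis opt : optimal w zeta alpha.
Hypothesis opt' : optimal w' zeta' alpha'.
Hypothesis ww' : forall m, w m <= w' m.
Hypothesis wk : w k = w' k.
Hypothesis k_mono : \forall s \ae mu, forall x y : R, 0 < x -> x <= y ->
  x * marginals s k x <= y * marginals s k y.

(** Spending falls while the endowment gains [(zeta' - zeta) * alpha0 k] in value. This gain makes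
    [excess_lt] strict: the price rises strictly in almost every state and [alpha0 k] is not
    null. *)
Let le_integrand : \forall s \ae mu,
  zeta' s * (alpha' k s - alpha0 k s) + (zeta' s - zeta s) * alpha0 k s
    <= zeta s * (alpha k s - alpha0 k s) /\ zeta s <= zeta' s.
Proof.
apply: filterS3 (opt_eff opt) (opt_eff opt') k_mono => s e e' mono.
have h := eff_spending_ge (inadaP s) e e' ww' wk mono.
by split; [lra|exact: (eff_price_le (inadaP s) e e' ww' k)].
Qed.

Lemma excess_le : excess zeta' (alpha' k) k <= excess zeta (alpha k) k.
Proof.
apply: ae_le_Rintegral; [exact: excess_integrable opt'|exact: excess_integrable opt|].
apply: filterS le_integrand => s [+ zz].
have : 0 <= (zeta' s - zeta s) * alpha0 k s.
  by rewrite mulr_ge0 ?subr_ge0//; exact: (alpha0_allocation.1 k).2.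
lra.
Qed.

Lemma excess_lt (j : 'I_M) : w j < w' j ->
  excess zeta' (alpha' k) k < excess zeta (alpha k) k.
Proof.
move=> wj; apply: ae_lt_Rintegral.
- exact: excess_integrable opt'.
- exact: excess_integrable opt.
- apply: filterS le_integrand => s [+ zz].
  have : 0 <= (zeta' s - zeta s) * alpha0 k s.
    by rewrite mulr_ge0 ?subr_ge0//; exact: (alpha0_allocation.1 k).2.
  lra.
move=> eq_integrand; apply: (alpha0_neq0 (m := k)).
apply: filterS3 le_integrand eq_integrand (filterI (opt_eff opt) (opt_eff opt')).
move=> s [+ zz] + [e e'] _.
have z_lt := eff_price_lt (inadaP s) e e' ww' wj.
move=> h1 h2; have a0 := (alpha0_allocation.1 k).2 s.
have h : (zeta' s - zeta s) * alpha0 k s <= 0 by lra.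
apply/eqP; rewrite eq_le a0 andbT.
by move: h; rewrite pmulr_rle0 ?subr_gt0.
Qed.

End ExcessComparison.

Lemma spending_le_bound (K : R) w zeta alpha (a : S -> R) (i : 'I_M) :
  (forall m, w m <= K) -> optimal w zeta alpha ->
  (\forall s \ae mu, `|a s| <= Lambda s) ->
  \forall s \ae mu, `|zeta s * a s| <= K * spending_bound s.
Proof.
move=> wK opt aL; have z0 := optimal_price_gt0 i opt.
apply: filterS3 (price_le_bound wK opt) aL z0 => s zb aL z0.
by apply: le_trans zb; rewrite normrM gtr0_norm// ler_pM2l.
Qed.

(** Dominated convergence: the bound [K] gives the envelope, and the solutions converge by [eff_cvg]
    off one null set common to the whole sequence. *)
Lemma excess_cvg (i : 'I_M) (K : R) (w_ : nat -> 'I_M -> R) (zeta_ : nat -> S -> R)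
    (alpha_ : nat -> 'I_M -> S -> R) w zeta alpha (k : 'I_M) :
  (forall n, optimal (w_ n) (zeta_ n) (alpha_ n)) -> optimal w zeta alpha ->
  (forall n m, w_ n m <= K) -> (forall m, w_ n m @[n --> \oo] --> w m) ->
  excess (zeta_ n) (alpha_ n k) k @[n --> \oo] --> excess zeta (alpha k) k.
Proof.
move=> opt_ opt w_K w_w.
have ma n : measurable_fun setT (alpha_ n k) by case: (opt_alloc (opt_ n) k).
have ma0 : measurable_fun setT (alpha0 k) by case: (alpha0_allocation.1 k).
apply: (Rintegral_dominated_cvg (g := fun s => K * spending_bound s)).
- move=> n; apply: measurable_funM; first exact: opt_price (opt_ n).
  exact: measurable_funB.
- apply: measurable_funM; first exact: opt_price opt.
  by apply: measurable_funB => //; case: (opt_alloc opt k).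
- by apply: integrable_realZ; exact: spending_bound_integrable.
- apply/ae_foralln => n; apply: (spending_le_bound i (w_K n) (opt_ n)).
  apply: filterS2 (allocation_le alpha0_allocation)
    (allocation_le (optimal_allocation (opt_ n))) => s /(_ k) a0L /(_ k) aL.
  move: a0L aL; rewrite ger0_norm ?(alpha0_allocation.1 k).2// => a0L.
  rewrite ger0_norm ?(opt_alloc (opt_ n) k).2// => aL.
  have := (alpha0_allocation.1 k).2 s; have := (opt_alloc (opt_ n) k).2 s.
  by rewrite ler_norml => h1 h2; apply/andP; split; lra.
have e_ : \forall s \ae mu, forall n,
    efficient (marginals s) (w_ n) (Lambda s) (zeta_ n s) ((alpha_ n)^~ s).
  by apply/ae_foralln => n; exact: opt_eff (opt_ n).
apply: filterS2 e_ (opt_eff opt) => s e_ e.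
have [zc ac] := eff_cvg (inadaP s) _ i e_ e w_w.
by apply: cvgM => //; apply: cvgB; [exact: ac|exact: cvg_cst].
Qed.

(* A measurable minorant of all the marginal utilities at [Lambda]. *)
Definition price_floor (s : S) : R :=
  \prod_m Num.min 1 (marginals s m (posLambda s)).

Lemma price_floor_gt0 s : 0 < price_floor s.
Proof.
apply: prodr_gt0 => m _.
by rewrite lt_min ltr01 (inada_gt0 (inadaP s m)) ?posLambda_gt0.
Qed.

Lemma measurable_price_floor : measurable_fun setT price_floor.
Proof.
apply: measurable_prod => m _; apply: measurable_minr => //.
have := measurable_marginal_utility_comp (UP m) measurable_posLambda.
rewrite (_ : [set _ | _] = setT)//; apply/seteqP; split=> // s _ /=.
exact: posLambda_gt0.
Qed.

Lemma price_floor_le (j : 'I_M) w zeta alpha : optimal w zeta alpha ->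
  w j = 1 -> \forall s \ae mu, price_floor s <= zeta s.
Proof.
move=> opt wj; apply: filterS2 (opt_eff opt) Lambda_gt0 => s e L0.
have v0 m : 0 < Num.min 1 (marginals s m (posLambda s)).
  by rewrite lt_min ltr01 (inada_gt0 (inadaP s m)) ?posLambda_gt0.
apply: (@le_trans _ _ (marginals s j (posLambda s))).
  apply: (@le_trans _ _ (Num.min 1 (marginals s j (posLambda s)))).
    rewrite /price_floor (bigD1 j)//=; apply: ler_piMr; first exact: ltW.
    apply: prodr_ile1 => m _.
    by rewrite ltW//= ge_min lexx.
  by rewrite ge_min lexx orbT.
rewrite (eff_price e j) wj mul1r /posLambda L0.
by rewrite (inada_le (inadaP s j)) ?(eff_gt0 e)//; exact: (eff_le _ e).
Qed.

(* An agent with a negligible weight consumes almost nothing, whereas the value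
   of his endowment stays away from 0. *)
Lemma excess_boundary (k : 'I_M) : exists2 delta : R, 0 < delta &
  forall w zeta alpha, optimal w zeta alpha -> (forall m, w m <= 1) ->
    (exists j, w j = 1) -> w k <= delta -> excess zeta (alpha k) k < 0.
Proof.
(* Otherwise, for every n, some weights with [w k <= 1 / (n + 2)] leave agent [k] a non-negative
   excess demand. These weights need not converge; the price floor and the common envelope
   suffice. *)
apply: contrapT => h.
have /choice[f fP] : forall n : nat,
    exists f : ('I_M -> R) * (S -> R) * ('I_M -> S -> R),
      [/\ optimal f.1.1 f.1.2 f.2, forall m, f.1.1 m <= 1,
          exists j, f.1.1 j = 1, f.1.1 k <= (n.+2%:R)^-1 &
          0 <= excess f.1.2 (f.2 k) k].
  move=> n; apply: contrapT => hn; apply: h; exists (n.+2%:R)^-1 => //.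
  move=> w zeta alpha opt w1 wj wk; rewrite ltNge; apply/negP => e0.
  by apply: hn; exists (w, zeta, alpha).
pose w_ n := (f n).1.1; pose zeta_ n := (f n).1.2; pose alpha_ n := (f n).2.
have opt n : optimal (w_ n) (zeta_ n) (alpha_ n) by case: (fP n).
have w1 n m : w_ n m <= 1 by have [_ + _ _ _] := fP n; exact.
have wk n : w_ n k <= (n.+2%:R)^-1 by case: (fP n).
have e0 n : 0 <= excess (zeta_ n) (alpha_ n k) k by case: (fP n).
have floor_le : \forall s \ae mu, forall n, price_floor s <= zeta_ n s.
  apply/ae_foralln => n; have [_ _ [j wj] _ _] := fP n.
  exact: price_floor_le (opt n) wj.
have alpha_le n : \forall s \ae mu, `|alpha_ n k s| <= Lambda s.
  by apply: filterS (allocation_le (optimal_allocation (opt n))) => s /(_ k).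
have eff_ : \forall s \ae mu, forall n,
    efficient (marginals s) (w_ n) (Lambda s) (zeta_ n s) ((alpha_ n)^~ s).
  by apply/ae_foralln => n; exact: opt_eff (opt n).
have bound_le : \forall s \ae mu, forall n,
    zeta_ n s * Lambda s <= 1 * spending_bound s.
  by apply/ae_foralln => n; exact: price_le_bound (w1 n) (opt n).
have to0 : \int[mu]_s (zeta_ n s * alpha_ n k s) @[n --> \oo] --> (0 : R).
  rewrite [X in _ --> X](_ : 0 = \int[mu]_(s in setT) (0 : R)); last first.
    by rewrite Rintegral_cst// mul0r.
  apply: (Rintegral_dominated_cvg (g := fun s => 1 * spending_bound s)) => //.
  - move=> n; apply: measurable_funM; first exact: opt_price (opt n).
    by case: (opt_alloc (opt n) k).
  - by apply: integrable_realZ; exact: spending_bound_integrable.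
  - by apply/ae_foralln => n; exact: (spending_le_bound k (w1 n) (opt n)).
  apply: filterS3 (filterI floor_le bound_le) eff_ Lambda_gt0 => s [fl bl] e L0.
  have fl0 := price_floor_gt0 s.
  (* Consuming [eps] would require a weight of at least [price_floor s / marginals s k eps], and
     [w_ n k] falls below it. *)
  have alpha_to0 : alpha_ n k s @[n --> \oo] --> (0 : R).
    apply/cvgrPdist_le => eps eps0.
    have v0 := inada_gt0 (inadaP s k) eps0.
    have h' : (n.+2%:R : R)^-1 * marginals s k eps @[n --> \oo] --> (0 : R).
      rewrite -[X in _ --> X](mul0r (marginals s k eps)).
      by apply: cvgMr_tmp; exact: cvg_harmonicS.
    have h2 : \forall n \near \oo, (n.+2%:R : R)^-1 * marginals s k eps < price_floor s.
      exact: (cvgr_lt _ h').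
    apply: filterS h2 => n hn.
    rewrite sub0r normrN ger0_norm ?(opt_alloc (opt n) k).2// ltW//.
    rewrite (eff_alloc_lt (inadaP s) _ (e n))//.
    apply: le_lt_trans (lt_le_trans hn (fl n)).
    by rewrite ler_pM2r.
  (* [zeta_ n s] need not converge, but it is at most [spending_bound s / Lambda s]. *)
  apply: (@squeeze_cvgr _ _ _ _ (cst 0)
    (fun n => spending_bound s / Lambda s * alpha_ n k s)).
  - apply: nearW => n /=; have a0 := (opt_alloc (opt n) k).2 s.
    rewrite mulr_ge0//=; last exact/ltW/(lt_le_trans fl0 (fl n)).
    by rewrite ler_wpM2r// ler_pdivlMr// -[leRHS]mul1r.
  - exact: cvg_cst.
  rewrite -[X in _ --> X](mulr0 (spending_bound s / Lambda s)).
  exact: cvgMl_tmp.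
have If : mu.-integrable setT (EFin \o (fun s => price_floor s * Lambda s)).
  apply: ae_le_integrable (optimal_price_integrable k (opt 0)) _.
    apply: measurable_funM; first exact: measurable_price_floor.
    exact: Lambda_L0plus.1.
  apply: filterS2 floor_le Lambda_gt0 => s /(_ 0) fl L0.
  have fl0 := price_floor_gt0 s.
  by rewrite ger0_norm ?ler_pM2r// mulr_ge0// ltW.
have fl0 : \forall s \ae mu, 0 < price_floor s.
  by apply: aeW => s; exact: price_floor_gt0.
have := alpha0_spending_gt0 measurable_price_floor fl0 If k.
rewrite ltNge => /negP; apply.
(* Non-negative excess demand keeps spending above the value of the endowment, hence above its value
   at the price floor, yet spending tends to 0. *)
apply: (cvgr_to_ge to0); apply: nearW => n.
apply: (@le_trans _ _ (\int[mu]_s (zeta_ n s * alpha0 k s))).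
  have zL := optimal_price_integrable k (opt n).
  apply: ae_le_Rintegral.
  - exact: (alpha0_spending_integrable measurable_price_floor).
  - exact: (alpha0_spending_integrable (opt_price (opt n)) (optimal_price_gt0 k (opt n))).
  apply: filterS floor_le => s /(_ n) fl; apply: ler_wpM2r => //.
  exact: (alpha0_allocation.1 k).2.
by rewrite -subr_ge0 -(excessE k _ (opt n)).
Qed.

(** * From weights that clear the budgets to an equilibrium *)

Lemma alpha0_budget_integrable (zeta b : S -> R) (m : 'I_M) :
  measurable_fun setT zeta -> measurable_fun setT b ->
  mu_expectation mu (fun s => (zeta s * (b s - alpha0 m s))%:E) = 0%E ->
  mu.-integrable setT (EFin \o (fun s => zeta s * (b s - alpha0 m s))).
Proof.
move=> mz mb; rewrite /mu_expectation => b0; apply: fin_num_integrable.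
  apply: measurable_funM => //; apply: measurable_funB => //.
  by case: (alpha0_allocation.1 m).
by rewrite b0.
Qed.

(** The lower bound comes from the tangent at [alpha m] evaluated at [Lambda]: the loss is at most
    marginal utility times [Lambda], that is, [zeta * Lambda / w m]. *)
Lemma optimal_utility_integrable (i : 'I_M) w zeta alpha m :
  optimal w zeta alpha ->
  mu.-integrable setT (EFin \o (fun s => fine (U m (alpha m s) s))).
Proof.
move=> opt; have La := opt_alloc opt m.
have IU : mu.-integrable setT (EFin \o (fun s => fine (U m (1 * Lambda s) s))).
  by apply: utility_integrable; rewrite ltr01 lexx.
have IUa : mu.-integrable setT
    (EFin \o (fun s => `|fine (U m (1 * Lambda s) s)|)).
  exact: (integrable_norm IU).
apply: (ae_le_integrable (g := fun s => `|fine (U m (1 * Lambda s) s)| +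
    (w m)^-1 * (zeta s * Lambda s))).
- by apply: measurableT_comp => //; exact: (measurable_utility_of (UP m) La).
- apply: integrable_realD => //; apply: integrable_realZ.
  exact: optimal_price_integrable opt.
apply: filterS2 (opt_eff opt) Lambda_gt0 => s e L0; rewrite mul1r.
have a0 := eff_gt0 e m; have aL := eff_le m e.
have w0 := eff_weight e m.
have v0 := inada_gt0 (inadaP s m) a0.
have h1 := utility_tangent (UP m) s a0 L0.
have h2 : fine (U m (alpha m s) s) <= fine (U m (Lambda s) s).
  by rewrite -lee_fin !(utility_fineK (UP m))// (utility_le (UP m)).
have zE : (w m)^-1 * (zeta s * Lambda s) = marginals s m (alpha m s) * Lambda s.
  by rewrite (eff_price e m); field; rewrite gt_eqF.
have h3 : 0 <= marginals s m (alpha m s) * alpha m s by rewrite mulr_ge0// ltW.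
have h4 : 0 <= marginals s m (alpha m s) * Lambda s by rewrite mulr_ge0// ltW.
rewrite zE ler_norml; rewrite /marginals in h3 h4 *.
have := ler_norm (fine (U m (Lambda s) s)).
have := ler_norm (- fine (U m (Lambda s) s)); rewrite normrN.
by move=> h5 h6; apply/andP; split; lra.
Qed.

Lemma optimal_equilibrium (i : 'I_M) w zeta alpha : (forall m, 0 < w m) ->
  optimal w zeta alpha -> (forall m, excess zeta (alpha m) m = 0) ->
  Arrow_Debreu_equilibrium mu U Lambda alpha0 zeta alpha.
Proof.
move=> w0 opt ex0; have mz := opt_price opt.
have z0 := optimal_price_gt0 i opt.
have UE m : \forall s \ae mu,
    utility_of (U m) (alpha m) s = (fine (U m (alpha m s) s))%:E.
  apply: filterS (opt_eff opt) => s e.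
  by rewrite (utility_fineK (UP m)) ?(eff_gt0 e).
have IU m := optimal_utility_integrable i m opt.
have budget m : mu_expectation mu
    (fun s => (zeta s * (alpha m s - alpha0 m s))%:E) = 0%E.
  rewrite /mu_expectation -[LHS]fineK; last first.
    exact: (integrable_fin_num _ (excess_integrable i m opt)).
  by congr EFin; exact: ex0.
have mU b m : L0plus b -> measurable_fun setT (utility_of (U m) b).
  exact: measurable_utility_of.
split => //.
- exact: optimal_allocation opt.
- have := integrable_fin_num measurableT (optimal_price_integrable i opt).
  by rewrite fin_numE => /andP[_]; rewrite -ltey.
move=> m; have La := opt_alloc opt m; split.
  have /integrableP[mf] := IU m; congr (_ < _)%E; apply: ae_eq_integral => //.
  - exact: measurableT_comp.
  - by apply: measurableT_comp => //; exact: mU.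
  - by apply: filterS (UE m) => s -> _.
split; first by split => //; exact: budget.
move=> b [Lb b_budget].
have Ib := alpha0_budget_integrable mz Lb.1 b_budget.
have Ia := excess_integrable i m opt.
(* The tangent at [alpha m] evaluated at [b], with marginal utility written [zeta / w m]. Both
   budget terms have integral 0, so [g] integrates to the expected utility of [alpha m]. That of [b]
   may be -oo. *)
pose g s := fine (U m (alpha m s) s) + (w m)^-1 *
  (zeta s * (b s - alpha0 m s) - zeta s * (alpha m s - alpha0 m s)).
have Ig : mu.-integrable setT (EFin \o g).
  by apply: integrable_realD => //; apply/integrable_realZ/integrable_realB.
have -> : mu_expectation mu (utility_of (U m) (alpha m)) =
    (\int[mu]_s (g s)%:E)%E.
  rewrite /mu_expectation.
  have -> : (\int[mu]_s (utility_of (U m) (alpha m) s) =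
      \int[mu]_s (EFin \o (fun s => fine (U m (alpha m s) s))) s)%E.
    apply: ae_eq_integral => //; first exact: mU.
      exact: measurable_int (IU m).
    by apply: filterS (UE m) => s -> _.
  rewrite -[LHS]fineK ?integrable_fin_num// -[RHS]fineK ?integrable_fin_num//.
  congr EFin; rewrite -/(Rintegral mu setT _) -/(Rintegral mu setT _).
  rewrite RintegralD//; last by apply/integrable_realZ/integrable_realB.
  rewrite RintegralZl//; last exact: integrable_realB.
  rewrite RintegralB// [X in X - _](_ : _ = 0); last first.
    by rewrite /Rintegral -/(mu_expectation _ _) b_budget.
  by rewrite -/(excess _ _ _) ex0 subrr mulr0 addr0.
apply: ae_le_integral.
- exact: mU.
- exact: measurable_int Ig.
apply: filterS (opt_eff opt) => s e.
have a0 := eff_gt0 e m.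
apply: le_trans (utility_tangent0 (UP m) s a0 (Lb.2 s)) _.
rewrite -(utility_fineK (UP m) s a0) -EFinD lee_fin /g.
rewrite lerD2l (eff_price e m) -mulrBr opprB addrA subrK mulrA mulrA.
by rewrite mulVf ?mul1r// gt_eqF.
Qed.

Lemma optimal_unique (i : 'I_M) w w' zeta zeta' alpha alpha' : w =1 w' ->
  optimal w zeta alpha -> optimal w' zeta' alpha' ->
  zeta = zeta' %[ae mu] /\ forall m, alpha m = alpha' m %[ae mu].
Proof.
move=> ww' opt opt'.
have H : \forall s \ae mu, zeta s = zeta' s /\ alpha^~ s =1 alpha'^~ s.
  apply: filterS2 (opt_eff opt) (opt_eff opt') => s e e'.
  exact: (eff_unique (inadaP s) i ww' e e').
by split=> [|m]; apply: filterS H => s [].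
Qed.

(** * Zeros of the excess demand *)

Section GrossSubstitutes.
Context (m0 : 'I_M).
Hypothesis spending_monotone : forall k : 'I_M, k != m0 ->
  \forall s \ae mu, forall x y : R, 0 < x -> x <= y ->
    x * marginals s k x <= y * marginals s k y.

Lemma excess_boundary_uniform : exists2 delta : R, 0 < delta <= 1 &
  forall k w zeta alpha, optimal w zeta alpha -> (forall m, w m <= 1) ->
    (exists j, w j = 1) -> w k <= delta -> excess zeta (alpha k) k < 0.
Proof.
have /choice[dl dlP] : forall k : 'I_M, exists delta : R, 0 < delta /\
  forall w zeta alpha, optimal w zeta alpha -> (forall m, w m <= 1) ->
    (exists j, w j = 1) -> w k <= delta -> excess zeta (alpha k) k < 0.
  by move=> k; have [delta d0 dP] := excess_boundary k; exists delta.
have sum0 : 0 <= \sum_k (dl k)^-1.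
  by apply: sumr_ge0 => k _; rewrite invr_ge0 ltW// (dlP k).1.
(* A positive lower bound of 1 and of all [dl k], in closed form. *)
exists ((1 + \sum_k (dl k)^-1)^-1).
  by rewrite invr_gt0 ltr_pwDl// invf_le1 ?lerDl// ltr_pwDl.
move=> k w zeta alpha opt w1 wj wk; have [dk0 dkP] := dlP k.
apply: (dkP _ _ _ opt w1 wj); apply: le_trans wk _.
rewrite -[leRHS]invrK lef_pV2 ?posrE ?invr_gt0 ?ltr_pwDl//.
rewrite (bigD1 k)//= addrCA lerDl addr_ge0// sumr_ge0// => j _.
by rewrite invr_ge0 ltW// (dlP j).1.
Qed.

(* The weights at which no agent but [m0] has a positive excess demand, and
   [m0] has weight 1, are stable under suprema and, by Walras' law, bounded:
   their coordinatewise supremum clears all budgets. *)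
Lemma equilibrium_weights : exists w zeta alpha, (forall m, 0 < w m) /\
  optimal w zeta alpha /\ forall m, excess zeta (alpha m) m = 0.
Proof.
have /choice[f fP] : forall w : 'I_M -> R, exists p : (S -> R) * ('I_M -> S -> R),
    (forall m, 0 < w m) -> optimal w p.1 p.2.
  move=> w; have [w0|w0] := pselect (forall m, 0 < w m).
    by have [z [a opt]] := optimal_exists m0 w0; exists (z, a).
  by exists (fun=> 0, fun _ _ => 0).
pose h k w := excess (f w).1 ((f w).2 k) k.
have h_le (w w' : 'I_M -> R) (k : 'I_M) : k != m0 -> (forall m, 0 < w m) ->
    (forall m, w m <= w' m) -> w k = w' k -> h k w' <= h k w.
  move=> km w0 ww' wk; have w'0 m : 0 < w' m := lt_le_trans (w0 m) (ww' m).
  exact: (excess_le (fP _ w0) (fP _ w'0) ww' wk (spending_monotone km)).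
have h_cvg (K : R) (w_ : nat -> 'I_M -> R) (w : 'I_M -> R) (k : 'I_M) :
    (forall n m, 0 < w_ n m) -> (forall m, 0 < w m) -> (forall n m, w_ n m <= K) ->
    (forall m, w_ n m @[n --> \oo] --> w m) -> h k (w_ n) @[n --> \oo] --> h k w.
  move=> w_0 w0 w_K w_w.
  exact: (@excess_cvg m0 K w_ (fun n => (f (w_ n)).1) (fun n => (f (w_ n)).2)
    w _ _ k (fun n => fP _ (w_0 n)) (fP _ w0) w_K w_w).
have h_sum (w : 'I_M -> R) : (forall m, 0 < w m) -> \sum_k h k w = 0.
  by move=> w0; exact: (walras m0 (fP _ w0)).
have [dl /andP[dl0 dl1] dlP] := excess_boundary_uniform.
pose P : set ('I_M -> R) := [set w | [/\ forall m, 0 < w m, w m0 = 1 &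
  forall k, k != m0 -> h k w <= 0]].
(* At weight [dl], against weight 1 for [m0], every other agent has negative excess demand. *)
have [w1 Pw1] : exists w, P w.
  exists (fun m => if m == m0 then 1 else dl).
  have w0 m : 0 < (if m == m0 then 1 else dl) by case: ifP.
  split => // [|k /negbTE km]; first by rewrite eqxx.
  apply/ltW/(dlP k _ _ _ (fP _ w0)) => [m||]; first by case: ifP.
    by exists m0; rewrite eqxx.
  by rewrite km.
(* Rescale so that the largest weight is 1: if some weight exceeded [dl^-1], that of [m0] would drop
   below [dl] and his excess demand would be negative, against Walras' law. *)
have P_bound w (m : 'I_M) : P w -> w m <= dl^-1.
  move=> [w0 wm0 hw]; rewrite leNgt; apply/negP => wm.
  have hm0 : 0 <= h m0 w.
    have := h_sum w w0; rewrite (bigD1 m0)//= => /eqP; rewrite addr_eq0 => /eqP->.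
    by rewrite oppr_ge0 sumr_le0.
  have [j _ wj] := @arg_maxP _ R _ m0 predT w isT.
  have c0 : 0 < (w j)^-1 by rewrite invr_gt0.
  have : excess (fun s => (w j)^-1 * (f w).1 s) ((f w).2 m0) m0 < 0.
    apply: (dlP m0 _ _ _ (optimal_scale c0 (fP _ w0))).
    - by move=> l; rewrite mulrC ler_pdivrMr// mul1r; exact: wj.
    - by exists j; rewrite mulVf// gt_eqF.
    rewrite wm0 mulr1 -[leRHS]invrK lef_pV2 ?posrE ?invr_gt0//.
    by apply/ltW/(lt_le_trans wm); exact: wj.
  by rewrite (excess_scale m0 _ _ (fP _ w0)) pmulr_rlt0// ltNge hm0.
pose B m : set R := [set w m | w in P].
pose W m := sup (B m).
have B_sup m : has_sup (B m).
  by split; [exists (w1 m), w1|exists dl^-1 => _ [w Pw <-]; exact: P_bound].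
have W_ge w (m : 'I_M) : P w -> w m <= W m.
  by move=> Pw; apply: sup_ubound; [case: (B_sup m)|exists w].
have W_le m : W m <= dl^-1.
  by apply: ge_sup; [case: (B_sup m)|move=> _ [w Pw <-]; exact: P_bound].
have W_adh m e : 0 < e -> exists2 w, P w & W m - e < w m.
  by move=> e0; have [_ [w Pw <-] we] := sup_adherent e0 (B_sup m); exists w.
have W0 m : 0 < W m.
  by apply: lt_le_trans (W_ge _ m Pw1); case: Pw1.
have Wm0 : W m0 = 1.
  apply/eqP; rewrite eq_le; apply/andP; split; last first.
    by apply: le_trans (W_ge _ m0 Pw1); case: Pw1 => _ ->.
  apply/ler_addgt0Pr => e e0; have [w [_ wm0 _]] := W_adh m0 e e0.
  by rewrite wm0 ltrBlDr => /ltW.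
(* Only coordinate [k] is varied and the others stay at the supremum, so that sequences of such
   weights converge to [W]. *)
pose upd k x : 'I_M -> R := fun m => if m == k then x else W m.
have upd_cvg k (x_ : nat -> R) : x_ n @[n --> \oo] --> W k ->
    forall m, upd k (x_ n) m @[n --> \oo] --> W m.
  move=> xW m; rewrite /upd; case: eqP => [->//|_]; exact: cvg_cst.
have t_cvg := @cvg_harmonicS R.
(* Take elements of [P] whose coordinate [k] tends to [W k]. Raising their other coordinates to [W]
   only lowers [h k], and the sign passes to the limit. *)
have hW_le k : k != m0 -> h k W <= 0.
  move=> km.
  have /choice[w_ w_P] : forall n : nat, exists w, P w /\ W k - (n.+2%:R)^-1 < w k.
    by move=> n; have [//|w Pw ww] := W_adh k (n.+2%:R)^-1; exists w.
  pose x_ n := w_ n k.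
  have x0 n : 0 < x_ n by have [[+ _ _] _] := w_P n; exact.
  have x_cvg : x_ n @[n --> \oo] --> W k.
    apply: (@squeeze_cvgr _ _ _ _ (fun n => W k - (n.+2%:R)^-1) (cst (W k))).
    - apply: nearW => n; have [Pn /ltW ->] := w_P n; exact: W_ge.
    - by rewrite -[X in _ --> X]subr0; apply: cvgB => //; exact: cvg_cst.
    - exact: cvg_cst.
  have v0 n m : 0 < upd k (x_ n) m by rewrite /upd; case: ifP.
  have vK n m : upd k (x_ n) m <= dl^-1.
    by rewrite /upd; case: ifP => // _; apply: P_bound; case: (w_P n).
  have c := h_cvg _ _ _ k v0 W0 vK (upd_cvg _ _ x_cvg).
  apply: (cvgr_to_le c); apply: nearW => n.
  have [Pn _] := w_P n; have [wn0 _ hn] := Pn.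
  apply: le_trans (hn _ km); apply: h_le => // [m|]; rewrite /upd ?eqxx//.
  by case: eqP => [->//|_]; exact: W_ge.
(* If [h k W] were negative, a slightly larger weight for [k] would keep it negative and lower the
   other excess demands, so it would remain in [P], above the supremum. *)
have hW0 k : k != m0 -> h k W = 0.
  move=> km; apply/eqP; rewrite eq_le hW_le//= leNgt; apply/negP => hk.
  pose x_ n : R := W k + (n.+2%:R)^-1.
  have x_gt n : W k < x_ n by rewrite ltrDl.
  have x_cvg : x_ n @[n --> \oo] --> W k.
    by rewrite -[X in _ --> X]addr0; apply: cvgD => //; exact: cvg_cst.
  have vW n m : W m <= upd k (x_ n) m.
    by rewrite /upd; case: eqP => [->|//]; exact: ltW.
  have v0 n m : 0 < upd k (x_ n) m := lt_le_trans (W0 m) (vW n m).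
  have vK n m : upd k (x_ n) m <= dl^-1 + 1.
    rewrite /upd; case: ifP => _; last by rewrite ler_wpDr.
    by rewrite lerD// invf_le1// ler1n.
  have c := h_cvg _ _ _ k v0 W0 vK (upd_cvg _ _ x_cvg).
  have : \forall n \near \oo, h k (upd k (x_ n)) < 0 by exact: (cvgr_lt _ c).
  case=> n _ /(_ n (leqnn n)) /= hn.
  have /(W_ge _ k) : P (upd k (x_ n)).
    split=> // [|j jm]; first by rewrite /upd eq_sym (negbTE km).
    have [->|jk] := eqVneq j k; first exact: ltW.
    apply: le_trans (hW_le j jm); apply: h_le => //.
    by rewrite /upd (negbTE jk).
  by rewrite /upd eqxx leNgt x_gt.
exists W, (f W).1, (f W).2; split=> //; split; first exact: fP.
move=> m; have [->|] := eqVneq m m0; last exact: hW0.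
have := h_sum W W0; rewrite (bigD1 m0)//= big1 ?addr0// => k; exact: hW0.
Qed.

Lemma equilibrium_unique w w' zeta zeta' alpha alpha' :
  (forall m, 0 < w m) -> (forall m, 0 < w' m) ->
  optimal w zeta alpha -> optimal w' zeta' alpha' ->
  (forall m, excess zeta (alpha m) m = 0) ->
  (forall m, excess zeta' (alpha' m) m = 0) ->
  same_equilibrium mu zeta alpha zeta' alpha'.
Proof.
move=> w0 w'0 opt opt' ex ex'.
pose r m := w' m / w m.
have r0 m : 0 < r m by rewrite divr_gt0.
have [j _ j_max] := @arg_maxP _ R _ m0 predT r isT.
have [l _ l_min] := @arg_minP _ R _ m0 predT r isT.
have rE m : r m * w m = w' m by rewrite divfK// gt_eqF.
have [rlj|rlj] := eqVneq (r l) (r j).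
  have ww' : (fun m => r j * w m) =1 w'.
    move=> m; rewrite -rE; congr (_ * _); apply/eqP; rewrite eq_le.
    by rewrite [X in _ && X](j_max m isT) -rlj (l_min m isT).
  have [zz aa] := optimal_unique m0 ww' (optimal_scale (r0 j) opt) opt'.
  split; first by exists (r j) => //; apply: filterS zz => s zz /zz.
  by move=> m; apply: filterS (aa m) => s am /am.
have rlj' : r l < r j by rewrite lt_neqAle rlj; exact: (l_min j isT).
(* The ratios at [l] and [j] differ, so at most one of these indices is [m0]. Rescaling by the ratio
   at the other makes the weights agree there and orders all the rest. *)
have [jm|jm] := eqVneq j m0.
  have lm : l != m0 by apply: contraNneq rlj => ->; rewrite jm.
  have ww' m : r l * w m <= w' m by rewrite -rE ler_pM2r//; exact: l_min.
  have := excess_lt (optimal_scale (r0 l) opt) opt' ww' (rE l)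
    (spending_monotone lm) (j := j).
  rewrite (excess_scale m0 _ _ opt) ex ex' mulr0 ltxx => h.
  by have : false by apply: h; rewrite -(rE j) ltr_pM2r.
have ww' m : w' m <= r j * w m by rewrite -rE ler_pM2r//; exact: j_max.
have := excess_lt opt' (optimal_scale (r0 j) opt) ww' (esym (rE j))
  (spending_monotone jm) (j := l).
rewrite (excess_scale m0 _ _ opt) ex ex' mulr0 ltxx => h.
by have : false by apply: h; rewrite -(rE l) ltr_pM2r.
Qed.

End GrossSubstitutes.
End Economy.

(** * First-order conditions of an agent *)

Section FirstOrderCondition.
Context (d : measure_display) (S : measurableType d) (R : realType).
Context (mu : {measure set S -> \bar R}) (U : R -> S -> \bar R).
Context (zeta a0 a : S -> R).
Hypothesis UP : utility_field U.
Hypothesis mu_sigma_finite : sigma_finite setT mu.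
Hypothesis mzeta : measurable_fun setT zeta.
Hypothesis zeta_gt0 : \forall s \ae mu, 0 < zeta s.
Hypothesis a0_L0plus : L0plus a0.
Hypothesis a0_neq0 : ~ (a0 = cst 0 %[ae mu]).
Hypothesis Ua_integrable :
  (mu_expectation mu (fun s => `|utility_of U a s|) < +oo)%E.
Hypothesis a_argmax :
  is_argmax (fun b => mu_expectation mu (utility_of U b))
    (budget_set mu zeta a0) a.

Let v (s : S) (c : R) : R := marginal_utility U c s.
Let vP s : inada (v s) := utility_inada UP s.

Let La : L0plus a. Proof. by case: a_argmax => -[]. Qed.

Let integrable_net : mu.-integrable setT (EFin \o (fun s => zeta s * (a s - a0 s))).
Proof.
case: a_argmax => -[_ budget] _; apply: fin_num_integrable.
  apply: measurable_funM => //.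
  by apply: measurable_funB; [exact: La.1|exact: a0_L0plus.1].
by move: budget; rewrite /mu_expectation => ->.
Qed.

Let restricted_integrable (A : set S) (K : R) : measurable A -> (mu A < +oo)%E ->
  (forall s, A s -> 0 < zeta s <= K) ->
  mu.-integrable setT (EFin \o (fun s => zeta s * \1_A s)).
Proof.
move=> mA muA hA.
have I1 : mu.-integrable setT (EFin \o (\1_A : S -> R)).
  apply/integrableP; split; first by apply/measurable_EFinP.
  under eq_integral do rewrite /= ger0_norm//.
  by rewrite integral_indic// setIT.
apply: (ae_le_integrable (g := fun s => K * \1_A s)).
- by apply: measurable_funM.
- exact: integrable_realZ.
apply: aeW => s; rewrite indicE; case: (boolP (s \in A)) => [|_].
  by rewrite inE => /hA /andP[z0 zK]; rewrite !mulr1 gtr0_norm.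
by rewrite !mulr0 normr0.
Qed.

Let restricted_gt0 (A : set S) (K : R) : measurable A -> (0 < mu A < +oo)%E ->
  (forall s, A s -> 0 < zeta s <= K) ->
  0 < \int[mu]_s (zeta s * \1_A s).
Proof.
move=> mA /andP[muA0 muA] hA; rewrite ltNge; apply/negP => h.
have : \forall s \ae mu, zeta s * \1_A s = 0.
  apply: Rintegral_eq0_ae h; first exact: restricted_integrable hA.
  apply: aeW => s; rewrite indicE; case: (boolP (s \in A)) => [|_].
    by rewrite inE => /hA /andP[z0 _]; rewrite mulr1 ltW.
  by rewrite mulr0.
move=> /(@negligibleS _ _ _ mu _ A) h'.
have /negligibleP : mu.-negligible A.
  apply: h' => s As /=; rewrite indicE mem_set// mulr1.
  by have /andP[/gt_eqF z0 _] := hA s As; move/eqP; rewrite z0.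
by move=> /(_ mA) muA00; rewrite muA00 ltxx in muA0.
Qed.

(* Moving consumption from [A], where its marginal value per unit of money is
   below [q1], to [B], where it exceeds [q2], would raise the expected
   utility. *)
Let no_improving_swap (A B : set S) (K eA eB q1 q2 : R) :
  measurable A -> measurable B -> (0 < mu A < +oo)%E -> (0 < mu B < +oo)%E ->
  0 < eA -> 0 < eB -> 0 < q1 -> q1 < q2 ->
  (forall s, A s -> 0 < zeta s <= K) -> (forall s, B s -> 0 < zeta s <= K) ->
  (forall s, A s -> eA < a s /\ v s (a s - eA) < q1 * zeta s) ->
  (forall s, B s -> q2 * zeta s < v s (a s + eB)) -> False.
Proof.
move=> mA mB muA muB eA0 eB0 q10 q12 zA zB hA hB.
have [ma a_ge0] := La.
have IA : mu.-integrable setT (EFin \o (fun s => zeta s * \1_A s)).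
  by apply: restricted_integrable zA => //; case/andP: muA.
have IB : mu.-integrable setT (EFin \o (fun s => zeta s * \1_B s)).
  by apply: restricted_integrable zB => //; case/andP: muB.
set JA := \int[mu]_s (zeta s * \1_A s).
set JB := \int[mu]_s (zeta s * \1_B s).
have JA0 : 0 < JA by exact: restricted_gt0 zA.
have JB0 : 0 < JB by exact: restricted_gt0 zB.
(* In a common state, decreasing marginal utility would put [q2 * zeta] below [q1 * zeta]. *)
have AB s : A s -> ~ B s.
  move=> As Bs; have [ae vA] := hA s As; have vB := hB s Bs.
  have z0 : 0 < zeta s by case/andP: (zA s As).
  have as0 : 0 < a s by exact: lt_trans ae.
  have h1 : v s (a s) < v s (a s - eA) by rewrite (inada_lt (vP s))//; lra.
  have h2 : v s (a s + eB) < v s (a s) by rewrite (inada_lt (vP s))//; lra.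
  have h3 : q1 * zeta s < q2 * zeta s by rewrite ltr_pM2r.
  by have := lt_trans (lt_trans h2 h1) (lt_trans vA h3); rewrite ltNge (ltW vB).
(* With [x = t * JB] and [y = t * JA] the swap costs [x * JA = y * JB] on both sides, and [x + y] is
   the minimum of [eA] and [eB]. *)
pose t := Num.min eA eB / (JA + JB).
have e0 : 0 < Num.min eA eB by rewrite lt_min eA0.
have t0 : 0 < t by rewrite divr_gt0// addr_gt0.
pose x := t * JB; pose y := t * JA.
have x0 : 0 < x by rewrite mulr_gt0.
have y0 : 0 < y by rewrite mulr_gt0.
have tJ : t * (JA + JB) = Num.min eA eB by rewrite divfK// gt_eqF// addr_gt0.
have xe : x <= eA.
  have : Num.min eA eB <= eA by rewrite ge_min lexx.
  by rewrite -tJ mulrDr -/x -/y; lra.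
have ye : y <= eB.
  have : Num.min eA eB <= eB by rewrite ge_min lexx orbT.
  by rewrite -tJ mulrDr -/x -/y; lra.
pose b s : R := a s - x * \1_A s + y * \1_B s.
have b_in_A s : A s -> b s = a s - x.
  by move=> As; rewrite /b !indicE mem_set// memNset ?mulr1 ?mulr0 ?addr0//; exact: AB.
have b_in_B s : B s -> b s = a s + y.
  move=> Bs; rewrite /b !indicE (mem_set Bs) memNset ?mulr1 ?mulr0 ?subr0//.
  by move=> /AB.
have b_out s : ~ A s -> ~ B s -> b s = a s.
  by move=> As Bs; rewrite /b !indicE !memNset// !mulr0 subr0 addr0.
have Lb : L0plus b.
  split.
    apply: measurable_funD; first apply: measurable_funB => //;
      by apply: measurable_funM.
  move=> s; have [As|As] := pselect (A s).
    by rewrite b_in_A//; have [] := hA s As; lra.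
  have [Bs|Bs] := pselect (B s); last by rewrite b_out.
  by rewrite b_in_B// addr_ge0// ltW.
have b_budget : budget_set mu zeta a0 b.
  split=> //; have [[_ a_budget] _] := a_argmax.
  pose g s := (zeta s * (a s - a0 s) + - x * (zeta s * \1_A s)) + y * (zeta s * \1_B s).
  have Ig1 : mu.-integrable setT (EFin \o (fun s =>
      zeta s * (a s - a0 s) + - x * (zeta s * \1_A s))).
    by apply: integrable_realD => //; exact: integrable_realZ.
  have Ig : mu.-integrable setT (EFin \o g).
    by apply: integrable_realD => //; exact: integrable_realZ.
  rewrite /mu_expectation.
  rewrite (_ : (fun s => _) = EFin \o g); last first.
    by apply/funext => s /=; congr EFin; rewrite /g /b; ring.
  rewrite -[LHS]fineK ?integrable_fin_num//; congr EFin.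
  rewrite -/(Rintegral mu setT g) RintegralD//; last exact: integrable_realZ.
  rewrite RintegralD//; last exact: integrable_realZ.
  rewrite !RintegralZl// -/JA -/JB [X in X + _ + _](_ : _ = 0); last first.
    by move: a_budget; rewrite /mu_expectation /Rintegral => ->.
  by rewrite /x /y; ring.
have mUa := measurable_utility_of UP La.
have IUa : mu.-integrable setT (utility_of U a) by apply/integrableP.
(* A lower bound of the gain in utility, with integral [(q2 - q1) * t * JA * JB]. *)
pose g s := - (q1 * x) * (zeta s * \1_A s) + q2 * y * (zeta s * \1_B s).
have Ig : mu.-integrable setT (EFin \o g).
  by apply: integrable_realD; exact: integrable_realZ.
have g0 : 0 < \int[mu]_s g s.
  rewrite RintegralD//; [|exact: integrable_realZ|exact: integrable_realZ].
  rewrite !RintegralZl// -/JA -/JB /x /y.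
  have : 0 < (q2 - q1) * (t * JA * JB) 
    by apply: mulr_gt0; [rewrite subr_gt0|apply: mulr_gt0 => //; exact: mulr_gt0].
  lra.
have Ub : (\int[mu]_s (utility_of U a s + (g s)%:E) <=
           \int[mu]_s utility_of U b s)%E.
  apply: ae_le_integral.
  - by apply: emeasurable_funD => //; exact: measurable_int Ig.
  - exact: measurable_utility_of.
  apply: aeW => s; rewrite /utility_of.
  have [As|As] := pselect (A s).
    have [ae vA] := hA s As; have /andP[z0 _] := zA s As.
    have ax0 : 0 < a s - x by lra.
    have vx : v s (a s - x) <= q1 * zeta s.
      apply: (le_trans _ (ltW vA)).
      have ae0 : 0 < a s - eA by rewrite subr_gt0.
      by rewrite (inada_le (vP s) ax0 ae0) lerD2l lerN2.
    rewrite b_in_A//.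
    have h := utility_tangent0 UP s ax0 (a_ge0 s).
    apply: le_trans (leeD2r _ h) _; rewrite -(utility_fineK UP s ax0) -!EFinD lee_fin.
    rewrite /g !indicE mem_set// memNset; last exact: AB.
    rewrite !mulr0 addr0 mulr1 subKr.
    have : v s (a s - x) * x <= q1 * zeta s * x by rewrite ler_pM2r.
    by rewrite /v; lra.
  have [Bs|Bs] := pselect (B s).
    have vB := hB s Bs; have /andP[z0 _] := zB s Bs.
    have ay0 : 0 < a s + y by rewrite ltr_wpDl.
    have vy : q2 * zeta s <= v s (a s + y).
      have ae0 : 0 < a s + eB by rewrite ltr_wpDl.
      by apply/ltW/(lt_le_trans vB); rewrite (inada_le (vP s) ae0 ay0) lerD2l.
    rewrite b_in_B//.
    have h := utility_tangent0 UP s ay0 (a_ge0 s).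
    apply: le_trans (leeD2r _ h) _; rewrite -(utility_fineK UP s ay0) -!EFinD lee_fin.
    rewrite /g !indicE (mem_set Bs) memNset// !mulr0 add0r mulr1.
    have : q2 * zeta s * y <= v s (a s + y) * y by rewrite ler_pM2r.
    by rewrite /v; lra.
  by rewrite b_out// /g !indicE !memNset// !mulr0 addr0 adde0.
have := a_argmax.2 b b_budget; rewrite /mu_expectation => /(le_trans Ub).
rewrite integralD//.
rewrite -[X in (X + _ <= X)%E]fineK ?integrable_fin_num//.
rewrite -[X in (_ + X <= _)%E]fineK ?integrable_fin_num//.
by rewrite -EFinD lee_fin gerDl leNgt g0.
Qed.

Let eps (n : nat) : R := (n.+2%:R)^-1.
Let eps_gt0 n : 0 < eps n. Proof. by rewrite /eps invr_gt0 ltr0n. Qed.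
Let eps_cvg : eps n @[n --> \oo] --> (0 : R). Proof. exact: cvg_harmonicS. Qed.
Let eps_lt (x : R) : 0 < x -> \forall n \near \oo, eps n < x.
Proof. by move=> x0; exact: (cvgr_lt _ eps_cvg). Qed.

Let measurable_marginal_at (b : S -> R) : measurable_fun setT b ->
  (forall s, 0 < b s) -> measurable_fun setT (fun s => v s (b s)).
Proof.
move=> mb b0; have := measurable_marginal_utility_comp UP mb.
by rewrite (_ : [set _ | _] = setT)//; apply/seteqP; split=> // s _; exact: b0.
Qed.

(** Cutting [Q n] down to a set of finite measure where the price is below [n] gives countably many
    sets that cover almost all of [P]; if all were null, so would be [P]. *)
Let exhaustion (P : S -> Prop) (Q : nat -> set S) :
  (forall n, measurable (Q n)) ->
  (forall s, 0 < zeta s -> P s -> \forall n \near \oo, Q n s) ->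
  ~ (\forall s \ae mu, ~ P s) ->
  exists A K n, [/\ measurable A, (0 < mu A < +oo)%E, A `<=` Q n &
    forall s, A s -> 0 < zeta s <= K].
Proof.
move=> mQ PQ; apply: contra_notP => nex.
have /sigma_finiteP[F [FT F_homo FP]] := mu_sigma_finite.
pose A n := (Q n `&` F n) `&`
  ([set s | 0 < zeta s] `&` [set s | zeta s < n%:R]).
have mA n : measurable (A n).
  apply: measurableI; first by apply: measurableI => //; case: (FP n).
  by apply: measurableI; apply: measurable_ltr_set.
have A0 n : mu.-negligible (A n).
  apply/(negligibleP mu (mA n))/eqP; rewrite eq_le measure_ge0 andbT leNgt.
  apply/negP => muA0; apply: nex; exists (A n), n%:R, n; split => //.
  - rewrite muA0/=; apply: le_lt_trans (FP n).2.
    by apply: le_measure; rewrite ?inE//; [case: (FP n)|move=> s [[]]].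
  - by move=> s [[]].
  - by move=> s [_ [/= -> /ltW ->]].
have : mu.-negligible (\bigcup_n A n) by exact: negligible_bigcup.
have nz : mu.-negligible (~` [set s | 0 < zeta s]) by exact: zeta_gt0.
move=> /(negligibleU nz); apply: negligibleS => s /= /contrapT Ps.
have [z0|z0] := pselect (0 < zeta s); [right|by left].
have [n0 _ Fn0] : (\bigcup_i F i) s by rewrite -FT.
have n1 : \forall n \near \oo, zeta s < n%:R.
  exact: nbhs_infty_gtr.
have n2 : \forall n \near \oo, F n s.
  by exists n0 => // n /= n0n; have /subsetPset := F_homo _ _ n0n; apply.
have : \forall n \near \oo, A n s.
  by apply: filterS3 (PQ s z0 Ps) n1 n2.
by case=> n _ /(_ n (leqnn n)) An; exists n.
Qed.

(** Only positive consumption can be given up; [q] is a utility per unit of money. *)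
Let cheap (q : R) (s : S) : Prop := 0 < a s /\ v s (a s) < q * zeta s.

(** If marginal utility per unit of money is below [q1] on a non-null set and above [q2] on another,
    or consumption vanishes there, [exhaustion] leaves room on both sides for a swap that
    contradicts optimality. *)
Let dichotomy (q1 q2 : R) : 0 < q1 -> q1 < q2 ->
  ~ (\forall s \ae mu, ~ cheap q1 s) ->
  \forall s \ae mu, 0 < a s /\ v s (a s) <= q2 * zeta s.
Proof.
move=> q10 q12 cheapA; apply: contrapT => dearB.
have [ma a_ge0] := La.
have q20 := lt_trans q10 q12.
(* The maximum keeps the argument of [v] positive in every state, for measurability; where
   [2 * eps n < a s] it is just [a s - eps n]. *)
have max_gt0 n s : 0 < Num.max (a s - eps n) (eps n) by rewrite lt_max eps_gt0 orbT.
have a_eps n s : 0 < a s + eps n by rewrite ltr_wpDl.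
have [A [K [n [mA muA AQ zA]]]] : exists A K n, [/\ measurable A,
    (0 < mu A < +oo)%E, A `<=` [set s | 2 * eps n < a s] `&`
      [set s | v s (Num.max (a s - eps n) (eps n)) < q1 * zeta s] &
    forall s, A s -> 0 < zeta s <= K].
  apply: exhaustion cheapA => [n|s z0 [as0 vq]].
    apply: measurableI; apply: measurable_ltr_set => //.
      apply: measurable_marginal_at => //; apply: measurable_maxr => //.
      exact: measurable_funB.
    exact: measurable_funM.
  (* At [c] the marginal utility is halfway to [q1 * zeta s], so any amount below [a s - c] may be
     taken away. *)
  have y0 : 0 < (v s (a s) + q1 * zeta s) / 2.
    by rewrite divr_gt0// addr_gt0 ?mulr_gt0// (inada_gt0 (vP s)).
  have [c c0 vc] := inada_surj (vP s) y0.
  have ca : c < a s by rewrite -(inada_lt (vP s) as0 c0) vc; lra.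
  have a20 : 0 < a s / 2 by rewrite divr_gt0.
  have ac0 : 0 < a s - c by rewrite subr_gt0.
  apply: filterS2 (eps_lt a20) (eps_lt ac0) => n n1 n2.
  have a2e : 2 * eps n < a s by lra.
  have ae0 : 0 < a s - eps n by have := eps_gt0 n; lra.
  split=> //=; rewrite max_l; last by lra.
  apply: (@lt_trans _ _ (v s c)); last by rewrite vc; lra.
  by rewrite (inada_lt (vP s) ae0 c0); lra.
have [B [K' [n' [mB muB BQ zB]]]] : exists B K n, [/\ measurable B,
    (0 < mu B < +oo)%E, B `<=` [set s | q2 * zeta s < v s (a s + eps n)] &
    forall s, B s -> 0 < zeta s <= K].
  apply: (@exhaustion (fun s => ~ (0 < a s /\ v s (a s) <= q2 * zeta s))) => [k|s z0 nd|].
  - apply: measurable_ltr_set; first exact: measurable_funM.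
    by apply: measurable_marginal_at => //; exact: measurable_funD.
  - have [c [c0 ac vc]] : exists c, [/\ 0 < c, a s < c & q2 * zeta s < v s c].
      (* Where nothing is consumed, the Inada condition at 0 yields marginal utilities above any
         level. *)
      have [as0|as0] := ltP 0 (a s); last first.
        have y0 : 0 < q2 * zeta s + 1 by rewrite addr_gt0 ?mulr_gt0.
        have [c c0 vc] := inada_surj (vP s) y0; exists c; split=> //.
          exact: le_lt_trans as0 c0.
        by rewrite vc ltrDl.
      have vq : q2 * zeta s < v s (a s).
        by rewrite ltNge; apply/negP => h; exact: nd.
      have y0 : 0 < (v s (a s) + q2 * zeta s) / 2.
        by rewrite divr_gt0// addr_gt0 ?mulr_gt0// (inada_gt0 (vP s)).
      have [c c0 vc] := inada_surj (vP s) y0; exists c; split=> //.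
        by rewrite -(inada_lt (vP s) c0 as0) vc; lra.
      by rewrite vc; lra.
    have ca0 : 0 < c - a s by rewrite subr_gt0.
    apply: filterS (eps_lt ca0) => k kc /=.
    apply: lt_trans vc _; rewrite (inada_lt (vP s) c0 (a_eps k s)); lra.
  - by move=> H; apply: dearB; apply: filterS H => s /contrapT.
pose L := Num.max K K'.
apply: (@no_improving_swap A B L (eps n) (eps n') q1 q2) => // s.
- by move=> /zA /andP[-> zK] /=; rewrite /L le_max zK.
- by move=> /zB /andP[-> zK] /=; rewrite /L le_max zK orbT.
- move=> /AQ[/= h1 h2]; have := eps_gt0 n => e0; split; first lra.
  by move: h2; rewrite max_l//; lra.
Qed.

Let not_ae_False : ~ (\forall s \ae mu, False).
Proof. by move=> F; apply: a0_neq0; apply: filterS F. Qed.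

(** Otherwise the budget equation would give the endowment [a0] the value 0 at positive prices. *)
Let a_neq0 : ~ (\forall s \ae mu, a s = 0).
Proof.
move=> a00; apply: a0_neq0.
have neg0 : \forall s \ae mu, 0 <= -1 * (zeta s * (a s - a0 s)).
  apply: filterS2 a00 zeta_gt0 => s -> z0.
  by rewrite sub0r mulrN mulN1r opprK mulr_ge0 ?(ltW z0)// a0_L0plus.2.
have Ineg := integrable_realZ (-1) integrable_net.
have : \forall s \ae mu, -1 * (zeta s * (a s - a0 s)) = 0.
  apply: (Rintegral_eq0_ae Ineg neg0); rewrite RintegralZl//.
  have [[_ budget] _] := a_argmax.
  by move: budget; rewrite /mu_expectation /Rintegral => ->; rewrite mulr0.
move=> H; apply: filterS3 H a00 zeta_gt0 => s h as0 z0 _.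
by move/eqP: h; rewrite as0 mulN1r oppr_eq0 mulf_eq0 gt_eqF//= sub0r oppr_eq0 => /eqP.
Qed.

(** The infimum [c] of the thresholds that are undercut on a non-null set is the constant ratio of
    marginal utility to price: [dichotomy] bounds the ratio above, minimality below. The weight is
    [c^-1]. *)
Lemma argmax_first_order : exists2 w : R, 0 < w &
  \forall s \ae mu, 0 < a s /\ zeta s = w * marginal_utility U (a s) s.
Proof.
have [ma a_ge0] := La.
pose E : set R := [set q | 0 < q /\ ~ (\forall s \ae mu, ~ cheap q s)].
have [qE [qE0 EqE]] : exists q, E q.
  apply: contrapT => nE; apply: a_neq0.
  have H : \forall s \ae mu, forall n : nat, ~ cheap n.+1%:R s.
    apply/ae_foralln => n; apply: contrapT => h; apply: nE.
    by exists n.+1%:R; split.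
  apply: filterS2 H zeta_gt0 => s h z0; apply/eqP; rewrite eq_le a_ge0 andbT.
  rewrite leNgt; apply/negP => as0.
  have [n _ /(_ n (leqnn n)) /= hn] := nbhs_infty_gtr (v s (a s) / zeta s).
  apply: (h n); split=> //; rewrite -ltr_pdivrMr//; apply: lt_trans hn _.
  by rewrite ltr_nat.
have E_lb : lbound E 0 by move=> q [/ltW].
have E_inf : has_inf E by split; [exists qE|exists 0].
pose c := inf E.
have v_le : \forall s \ae mu, 0 < a s /\ v s (a s) <= c * zeta s.
  have H : \forall s \ae mu, forall n, 0 < a s /\ v s (a s) <= (c + eps n) * zeta s.
    apply/ae_foralln => n; have [q [q0 Eq] qc] := inf_adherent (eps_gt0 n) E_inf.
    exact: dichotomy Eq.
  apply: filterS H => s h; split; first by case: (h 0%N).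
  have c_cvg : (c + eps n) * zeta s @[n --> \oo] --> (c + 0) * zeta s.
    by apply: cvgMr_tmp; apply: cvgD => //; exact: cvg_cst.
  rewrite addr0 in c_cvg.
  by apply: (cvgr_to_ge c_cvg); apply: nearW => n; case: (h n).
have c_ge0 : 0 <= c by apply: lb_le_inf => //; exists qE.
have c0 : 0 < c.
  rewrite lt_neqAle c_ge0 andbT; apply/negP => /eqP c0; apply: not_ae_False.
  apply: filterS v_le => s [as0]; rewrite -c0 mul0r leNgt.
  by rewrite (inada_gt0 (vP s)).
have v_ge : \forall s \ae mu, c * zeta s <= v s (a s).
  (* Thresholds below the infimum are outside [E]; the factor [1 - eps n] keeps them positive. *)
  have H : \forall s \ae mu, forall n, ~ cheap (c * (1 - eps n)) s.
    apply/ae_foralln => n; apply: contrapT => h.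
    have e1 : eps n < 1 by rewrite /eps invf_lt1 ?ltr0n// ltr1n.
    have q0 : 0 < c * (1 - eps n) by rewrite mulr_gt0// subr_gt0.
    have : c <= c * (1 - eps n) by apply: ge_inf; [exists 0|split].
    by rewrite ler_pMr// lerBrDr gerDl leNgt eps_gt0.
  apply: filterS2 H v_le => s h [as0 _].
  have c_cvg : c * (1 - eps n) * zeta s @[n --> \oo] --> c * (1 - 0) * zeta s.
    apply: cvgMr_tmp; apply: cvgMl_tmp; apply: cvgB => //; exact: cvg_cst.
  rewrite subr0 mulr1 in c_cvg.
  apply: (cvgr_to_le c_cvg); apply: nearW => n; rewrite leNgt; apply/negP => hn.
  by apply: (h n).
exists c^-1; first by rewrite invr_gt0.
apply: filterS2 v_le v_ge => s [as0 h1] h2; split=> //.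
have -> : marginal_utility U (a s) s = c * zeta s.
  by apply/eqP; rewrite eq_le; apply/andP.
by rewrite mulKf// gt_eqF.
Qed.

End FirstOrderCondition.

(** * Existence and uniqueness of the equilibrium *)

(* The exceptional sets of rational pairs cover all the others by continuity. *)
Lemma ae_marginal_spending_monotone (d : measure_display) (S : measurableType d)
    (R : realType) (mu : {measure set S -> \bar R}) (U : R -> S -> \bar R) :
  utility_field U ->
  (forall c1 c2 : R, 0 < c1 -> c1 <= c2 -> \forall s \ae mu,
    c1 * marginal_utility U c1 s <= c2 * marginal_utility U c2 s) ->
  \forall s \ae mu, forall x y : R, 0 < x -> x <= y ->
    x * marginal_utility U x s <= y * marginal_utility U y s.
Proof.
move=> UP mono; pose g s (c : R) := c * marginal_utility U c s.
have H : \forall s \ae mu, forall n : nat,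
    if unpickle n is Some (p, q) then
      0 < ratr p :> R -> ratr p <= ratr q :> R -> g s (ratr p) <= g s (ratr q)
    else True.
  apply/ae_foralln => n; case: unpickle => [[p q]|]; last exact: aeW.
  have [p0|p0] := pselect (0 < ratr p :> R); last by apply: aeW.
  have [pq|pq] := pselect (ratr p <= ratr q :> R); last by apply: aeW.
  by apply: filterS (mono _ _ p0 pq) => s.
apply: filterS H => s H x y x0.
rewrite le_eqVlt => /predU1P[->//|xy]; rewrite leNgt; apply/negP => gyx.
have y0 := lt_trans x0 xy.
have g_cont c : 0 < c -> {for c, continuous (g s)}.
  by move=> c0; apply: cvgM; [exact: cvg_id|exact: utility_C1].
pose z := (g s y + g s x) / 2.
have [zx zy] : z < g s x /\ g s y < z.
  by rewrite /g in gyx; rewrite /z /g; split; lra.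
(* The rationals near [x] and [y] are kept on either side of the midpoint, hence in order. *)
pose m := (x + y) / 2.
have [xm my] : x < m /\ m < y by rewrite /m; split; lra.
have [e1 /= e10 h1] : exists2 e, 0 < e & forall t, `|x - t| < e -> z < g s t.
  have : \forall t \near x, z < g s t by exact: (cvgr_gt _ (g_cont _ x0)).
  by move=> /nbhs_ballP[e /= e0 h]; exists e.
have [e2 /= e20 h2] : exists2 e, 0 < e & forall t, `|y - t| < e -> g s t < z.
  have : \forall t \near y, g s t < z by exact: (cvgr_lt _ (g_cont _ y0)).
  by move=> /nbhs_ballP[e /= e0 h]; exists e.
have xp : x < Num.min m (x + e1) by rewrite lt_min xm ltrDl.
have qy : Num.max m (y - e2) < y by rewrite gt_max my gtrBl.
have [p] := rat_in_itvoo xp; rewrite in_itv/= lt_min => /and3P[p1 p2 p3].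
have [q] := rat_in_itvoo qy; rewrite in_itv/= gt_max => /andP[/andP[q1 q2] q3].
have := H (pickle (p, q)); rewrite pickleK => /(_ (lt_trans x0 p1)).
move=> /(_ (ltW (lt_trans p2 q1))); rewrite leNgt => /negP; apply.
apply: lt_trans (h2 _ _) (h1 _ _).
  by rewrite gtr0_norm ?subr_gt0//; lra.
by rewrite ltr0_norm ?subr_lt0//; lra.
Qed.

(** Each agent's own problem supplies a multiplier at the common price [zeta]; there are finitely
    many agents, so one null set serves them all and the multipliers are the weights. *)
Lemma equilibrium_optimal (d : measure_display) (S : measurableType d)
    (R : realType) (mu : {measure set S -> \bar R}) (M : nat)
    (U : 'I_M -> R -> S -> \bar R) (Lambda : S -> R) (alpha0 : 'I_M -> S -> R)
    (zeta : S -> R) (alpha : 'I_M -> S -> R) :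
  sigma_finite setT mu -> (forall m, utility_field (U m)) ->
  allocation mu Lambda alpha0 ->
  (forall m, ~ (alpha0 m = cst 0 %[ae mu])) ->
  Arrow_Debreu_equilibrium mu U Lambda alpha0 zeta alpha ->
  exists w : 'I_M -> R, [/\ forall m, 0 < w m,
    optimal mu U Lambda w zeta alpha &
    forall m, excess mu alpha0 zeta (alpha m) m = 0].
Proof.
move=> mu_sf UP [La0 _] a0_neq0 [mz z0 [La sumL] _ eq].
have /choice[w wP] : forall m, exists w : R, 0 < w /\
    \forall s \ae mu, 0 < alpha m s /\
      zeta s = w * marginal_utility (U m) (alpha m s) s.
  move=> m; have [fin amax] := eq m.
  have [w w0 wP] := argmax_first_order (UP m) mu_sf mz z0 (La0 m) (@a0_neq0 m) fin amax.
  by exists w.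
have w0 m : 0 < w m by case: (wP m).
exists w; split=> // [|m].
  split=> //.
  have H : \forall s \ae mu, forall m, 0 < alpha m s /\
      zeta s = w m * marginal_utility (U m) (alpha m s) s.
    by apply: filter_forall => m; case: (wP m).
  by apply: filterS2 H sumL => s h /(_ I) sL; split=> // m; case: (h m).
have [_ [[_ budget] _]] := eq m.
by move: budget; rewrite /mu_expectation /excess /Rintegral => ->.
Qed.

Local Open Scope ereal_scope.

Theorem theorem2 (d : measure_display) (S : measurableType d) (R : realType)
    (mu : {sigma_finite_measure set S -> \bar R})
    (M : nat) (M_gt0 : (0 < M)%N)
    (U : 'I_M -> R -> S -> \bar R)
    (U_utility : forall m, utility_field (U m))
    (Lambda : S -> R) (Lambda_L0plus : L0plus Lambda)
    (Lambda_gt0 : \forall s \ae mu, (0 < Lambda s)%R)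
    (alpha0 : 'I_M -> S -> R)
    (alpha0_allocation : allocation mu Lambda alpha0)
    (alpha0_neq0 : forall m, ~ (alpha0 m = cst 0%R %[ae mu]))
    (U_integrable : forall (t : R) (m : 'I_M), (0 < t <= 1)%R ->
       mu_expectation mu
         (fun s => `|utility_of (U m) (fun s' => (t * Lambda s')%R) s|) < +oo)
    (U_monotone : exists m0 : 'I_M, forall m : 'I_M, m != m0 ->
       forall c1 c2 : R, (0 < c1)%R -> (c1 <= c2)%R ->
         \forall s \ae mu, (c1 * marginal_utility (U m) c1 s
                            <= c2 * marginal_utility (U m) c2 s)%R) :
  exists (zeta : S -> R) (alpha1 : 'I_M -> S -> R),
    Arrow_Debreu_equilibrium mu U Lambda alpha0 zeta alpha1 /\
    forall (zeta' : S -> R) (alpha1' : 'I_M -> S -> R),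
      Arrow_Debreu_equilibrium mu U Lambda alpha0 zeta' alpha1' ->
      same_equilibrium mu zeta alpha1 zeta' alpha1'.
Proof.
have [m0 mono] := U_monotone.
have spending_mono k : k != m0 -> \forall s \ae mu, forall x y : R,
    (0 < x)%R -> (x <= y)%R -> (x * marginals U s k x <= y * marginals U s k y)%R.
  by move=> km; exact: (ae_marginal_spending_monotone (U_utility k) (mono k km)).
have [w [zeta [alpha [w0 [opt ex]]]]] := equilibrium_weights U_utility
  Lambda_L0plus Lambda_gt0 alpha0_allocation alpha0_neq0 U_integrable spending_mono.
exists zeta, alpha; split.
  exact: (optimal_equilibrium U_utility Lambda_L0plus Lambda_gt0
    alpha0_allocation U_integrable m0 w0 opt ex).
move=> zeta' alpha' eq'.
have [w' [w'0 opt' ex']] := equilibrium_optimal (sigma_finiteT mu) U_utility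
  alpha0_allocation alpha0_neq0 eq'.
exact: (equilibrium_unique U_utility Lambda_L0plus Lambda_gt0 alpha0_allocation
  alpha0_neq0 U_integrable spending_mono w0 w'0 opt opt' ex ex').
Qed.
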